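(* Let $\varepsilon>0$, let $(X,d_X)$ and $(Y,d_Y)$ be complete separable metric spaces, $c:X\times Y\to\mathbb{R}$ a bounded cost function, $\Phi$ an Entropy, $\Psi=\Phi^*$, and let $\rho_1\in\mathcal{P}(X)$, $\rho_2\in\mathcal{P}(Y)$ be probability measures. Then, given $u^*\in L^{\Phi}_{\varepsilon}(\rho_1)$ and $v^*\in L^{\Phi}_{\varepsilon}(\rho_2)$, the following are equivalent: (1) (Maximizers) $u^*$ and $v^*$ are maximizing potentials for the dual problem $\sup\{D_{\varepsilon}(u,v): u\in L^{\Phi}_{\varepsilon}(\rho_1),\ v\in L^{\Phi}_{\varepsilon}(\rho_2)\}$; (2) (Maximality condition) $\mathcal{F}^{(c,\varepsilon,\Phi)}(u^* )=v^*$ and $\mathcal{F}^{(c,\varepsilon,\Phi)}(v^* )=u^*$ (in particular $u^*\in L^\infty(\rho_1)$ and $v^*\in L^\infty(\rho_2)$); (3) (Complementary slackness) letting $\gamma^*=\Psi'\big((u^*(x)+v^*(y)-c(x,y))/\varepsilon\big)\cdot\rho_1\otimes\rho_2$, one has $\gamma^*\in\Pi(\rho_1,\rho_2)$; (4) (Duality) $\mathrm{OT}_{\varepsilon}(\rho_1,\rho_2)=D_{\varepsilon}(u^*,v^* )$. Moreover, in those cases $\gamma^*$, as defined in (3), is also the (unique) minimizer of the problem defining $\mathrm{OT}_{\varepsilon}(\rho_1,\rho_2)$.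
   Context: An Entropy is a function $\Phi:[0,+\infty]\to[0,+\infty]$ that is convex, lower semi-continuous, superlinear at infinity, with $\Phi\in C^1((0,\infty))$ and $\Phi(1)=\Phi'(1)=0$. $\Psi=\Phi^*$ is its Legendre conjugate and $\Psi'$ the derivative of $\Psi$. $\Pi(\rho_1,\rho_2)$ is the set of probability measures on $X\times Y$ with marginals $\rho_1,\rho_2$. The regularized optimal transport problem is $$\mathrm{OT}_{\varepsilon}(\rho_1,\rho_2)=\inf_{\gamma\in\Pi(\rho_1,\rho_2)}\int_{X\times Y}c\,d\gamma+\varepsilon G(\gamma|\rho_1\otimes\rho_2),$$ where $G(\gamma|\rho_1\otimes\rho_2)=\int_{X\times Y}\Phi\big(\frac{d\gamma}{d(\rho_1\otimes\rho_2)}\big)d(\rho_1\otimes\rho_2)$ if $\gamma\ll\rho_1\otimes\rho_2$ and $+\infty$ otherwise. For a probability measure $\rho$ on $X$, $L^{\Phi}_{\varepsilon}(\rho)=L^{\Phi}_{\varepsilon}(X,\rho)$ is the set of measurable $u:X\to[-\infty,\infty)$ with $0<\int_X\Psi(u/\varepsilon)\,d\rho<\infty$ (similarly on $Y$). The dual functional is $$D_{\varepsilon}(u,v)=\int_X u\,d\rho_1+\int_Y v\,d\rho_2-\varepsilon\int_{X\times Y}\Psi\Big(\frac{u(x)+v(y)-c(x,y)}{\varepsilon}\Big)d(\rho_1\otimes\rho_2).$$ The $(c,\varepsilon,\Phi)$-transform of $u\in L^{\Phi}_{\varepsilon}(\rho_1)$ is the function on $Y$ given by $\mathcal{F}^{(c,\varepsilon,\Phi)}(u)\in\operatorname{argmax}\{D_{\varepsilon}(u,v):v\in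 L^{\Phi}_{\varepsilon}(\rho_2)\}$; the transform of $v\in L^{\Phi}_{\varepsilon}(\rho_2)$ is the function on $X$ given by $\mathcal{F}^{(c,\varepsilon,\Phi)}(v)\in\operatorname{argmax}\{D_{\varepsilon}(u,v):u\in L^{\Phi}_{\varepsilon}(\rho_1)\}$. Functions are identified up to null sets.
   Formalization: Adds that Ψ is differentiable on ℝ (else Ψ′ is undefined and uniqueness fails, e.g. Φ=0 on [1/2,2], c=1, ε=1, u*=v*=1/2) and that c is Borel measurable; in (2) a transform must give D_ε>−∞, so the argmax of a functional identically −∞ is empty. *)

(* Defs.v *)
From HB Require Import structures.
From mathcomp Require Import all_boot all_order all_algebra.
From mathcomp Require Import all_classical all_reals all_analysis measurable_realfun.

Set Implicit Arguments.
Unset Strict Implicit.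
Unset Printing Implicit Defensive.

Import Order.TTheory GRing.Theory Num.Theory.
Import numFieldNormedType.Exports.

Local Open Scope classical_set_scope.
Local Open Scope ring_scope.
Local Open Scope charge_scope.
Local Open Scope ereal_scope.

#[short(type="completeMetricType")]
HB.structure Definition CompleteMetric (R : numDomainType) :=
  {T of Metric R T & Complete T}.

Definition separable (T : topologicalType) : Prop :=
  exists2 S : set T, countable S & dense S.

(* The product measurableType [borel X * borel Y] carries the product
   sigma-algebra, which is the Borel one when X and Y are separable. *)
Notation borel X := (g_sigma_algebraType (@open X)).

Section entropy.
Context {R : realType}.
Implicit Types Phi : \bar R -> \bar R.

(* An entropy lives on [0, +oo]; as usual in convex analysis it is extended by
   +oo to the negative numbers, and its value at +oo is the limit +oo imposed
   by superlinearity. *)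
Record is_entropy Phi : Prop := {
  entropy_lt0 : forall t, t < 0 -> Phi t = +oo ;
  entropy_ge0 : forall t, 0 <= Phi t ;
  entropy_convex : forall (s t : \bar R) (l : R),
    0 <= s -> 0 <= t -> (0 <= l <= 1)%R ->
    Phi (l%:E * s + (1 - l)%:E * t) <= l%:E * Phi s + (1 - l)%:E * Phi t ;
  entropy_lsc : lower_semicontinuous Phi ;
  entropy_superlinear : Phi t%:E * (t^-1)%:E @[t --> +oo%R] --> +oo ;
  entropy_pinfty : Phi +oo = +oo ;
  entropy_fin_num : forall t : R, (0 < t)%R -> Phi t%:E \is a fin_num ;
  entropy_derivable : forall t : R, (0 < t)%R ->
    derivable (fun s : R => fine (Phi s%:E)) t 1%R ;
  entropy_C1 : forall t : R, (0 < t)%R ->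
    {for t, continuous (fun s : R => fine (Phi s%:E))^`()%classic} ;
  entropy1 : Phi 1 = 0 ;
  entropy_deriv1 : (fun s : R => fine (Phi s%:E))^`()%classic 1%R = 0%R }.

(* Since 0 * -oo = 0, this gives conjugate Phi -oo = - Phi 0. *)
Definition conjugate Phi (y : \bar R) : \bar R :=
  ereal_sup [set t * y - Phi t | t in [set t | 0 <= t]].

(* The conjugate of an entropy is finite on the real line. *)
Definition conjugate_real Phi (y : R) : R := fine (conjugate Phi y%:E).

(* Derivative of the conjugate, extended by its limits at -oo and +oo.  It is
   meaningful when conjugate_real Phi is derivable, which convexity of Phi
   alone does not ensure (strict convexity does). *)
Definition conjugate' Phi (y : \bar R) : \bar R :=
  match y with
  | r%:E => ((conjugate_real Phi)^`()%classic r)%:E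
  | -oo => 0
  | +oo => +oo
  end.

Definition Lphi d (T : measurableType d) (Phi : \bar R -> \bar R) (eps : R)
    (rho : probability T R) : set (T -> \bar R) :=
  [set u | [/\ measurable_fun [set: T] u, (forall x, u x < +oo) &
    0 < \int[rho]_x conjugate Phi ((eps^-1)%:E * u x) < +oo]].

End entropy.

(* As usual, the argmax of a functional identically equal to -oo on the
   feasible set is empty. *)
Definition argmax {R : realType} {T : Type} (S : set T) (F : T -> \bar R) :
    set T :=
  [set x | [/\ S x, -oo < F x & forall y, S y -> F y <= F x]].

Section regularized_ot.
Context {R : realType} {d1 d2 : measure_display}.
Context {X : measurableType d1} {Y : measurableType d2}.
Variables (Phi : \bar R -> \bar R) (eps : R) (c : X * Y -> R).
Variables (rho1 : probability X R) (rho2 : probability Y R).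
Implicit Types (g : probability (X * Y)%type R).
Implicit Types (u : X -> \bar R) (v : Y -> \bar R).

Definition couplings : set (probability (X * Y)%type R) :=
  [set g | (forall A, measurable A -> g (A `*` [set: Y]) = rho1 A) /\
           (forall B, measurable B -> g ([set: X] `*` B) = rho2 B)].

Definition divergence g : \bar R :=
  if `[< g `<< rho1 \x rho2 >] then
    \int[rho1 \x rho2]_z
      Phi (('d (charge_of_finite_measure g)
            '/d (rho1 \x rho2 : probability (X * Y)%type R)) z)
  else +oo.

Definition primal g : \bar R :=
  \int[g]_z (c z)%:E + eps%:E * divergence g.

Definition OT : \bar R := ereal_inf [set primal g | g in couplings].

Definition is_minimizer g : Prop := couplings g /\ primal g = OT.

Definition slack u v (z : X * Y) : \bar R :=
  (eps^-1)%:E * (u z.1 + v z.2 - (c z)%:E).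

(* On Lphi the integrals of u and v are < +oo.  If one of them is -oo, then so
   is the value, because -oo absorbs +oo in the library; otherwise the last
   integral is well defined in ]-oo, +oo]. *)
Definition dual u v : \bar R :=
  \int[rho1]_x u x + \int[rho2]_y v y
  - eps%:E * \int[rho1 \x rho2]_z conjugate Phi (slack u v z).

Definition dual_sup : \bar R :=
  ereal_sup [set dual p.1 p.2 | p in Lphi Phi eps rho1 `*` Lphi Phi eps rho2].

Definition is_transform_of_left u v : Prop :=
  argmax (Lphi Phi eps rho2) (dual u) v.

Definition is_transform_of_right v u : Prop :=
  argmax (Lphi Phi eps rho1) (dual ^~ v) u.

Definition gamma_star u v (A : set (X * Y)) : \bar R :=
  \int[rho1 \x rho2]_(z in A) conjugate' Phi (slack u v z).

Definition is_gamma_star u v g : Prop :=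
  forall A, measurable A -> g A = gamma_star u v A.

End regularized_ot.

(* Main.v *)
Require Import Defs.
From HB Require Import structures.
From mathcomp Require Import all_boot all_order all_algebra.
From mathcomp Require Import all_classical all_reals all_analysis measurable_realfun.
From mathcomp Require Import ring lra.

(* After rescaling the potentials by eps the dual functional is
   D = \int a + \int b - \int psi (a + b - k), with psi the conjugate of Phi.
   Every step is reduced to the marginal equations: the density
   dpsi (a + b - k) has marginals rho1 and rho2.
   - If a maximizes D for b fixed, decreasing a on a set where it is bounded
     keeps all integrals finite, whatever the growth of psi, and Fatou's lemma
     gives one inequality in the marginal equations.  Since dpsi is unbounded
     this inequality bounds a and b from above; increasing a is then harmless
     too and dominated convergence gives the reverse inequality.
   - The marginal equations bound a and b from below because dpsi < 1 near -oo,
     so that all the integrals in play are finite.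
   - Integrating Young's inequality Phi q + psi s >= q s against a coupling of
     density q gives weak duality; equality holds iff q = dpsi s almost
     everywhere, which gives strong duality and the uniqueness of the minimizer.
*)

Set Implicit Arguments.
Unset Strict Implicit.

Import Order.TTheory GRing.Theory Num.Theory.
Import numFieldNormedType.Exports.

Local Open Scope classical_set_scope.
Local Open Scope ring_scope.
Local Open Scope ereal_scope.
Local Open Scope charge_scope.

(** * Convex analysis of the conjugate entropy *)

(** Two features of the class of potentials shape the proof. A potential may take the value [-oo];
    real representatives become available once this value is confined to a null set, either because
    a dual value above [-oo] makes the potentials integrable, or because [gamma_star] puts no mass
    where a potential is [-oo]. Moreover a competitor must keep the integral of its conjugate both
    finite and strictly positive. Since [psi] may grow arbitrarily fast, adding even a constant to
    an unbounded potential can destroy finiteness, while lowering it can destroy positivity; this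
    dictates the direction and the size of each variation, and forces a second round of variations
    once upper bounds are known. Maximality in each potential separately implies joint maximality
    because each partial problem yields one of the two marginal equations, and the pair of equations
    already makes [gamma_star] a coupling whose primal value equals the dual value. *)

Section conjugate_of_entropy.
Context {R : realType}.
Variable Phi : \bar R -> \bar R.
Hypothesis H : is_entropy Phi.
Local Notation psi := (conjugate_real Phi).

(** Superlinearity makes [t * y - Phi t] nonpositive once [t] exceeds both [T] and [0], hence beyond
    [M]; on [[0, M]] it is at most [M * |y|] because [Phi >= 0]. *)
Lemma conjugate_ub (y : R) : exists M : R, conjugate Phi y%:E <= M%:E.
Proof.
have := entropy_superlinear H; move=> /cvgeyPge /(_ y) [T [_ HT]].
pose M := Num.max (T + 1)%R 1%R.
have M0 : (0 < M)%R by rewrite /M lt_max ltr01 orbT.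
exists (M * `|y|)%R; apply: ge_ereal_sup => _ [t /= t0 <-].
case: t t0 => [t|_|//]; last by rewrite (entropy_pinfty H) /= addeNy leNye.
rewrite lee_fin => t0.
have := entropy_ge0 H t%:E.
have [tM|Mt] := leP t M.
  case: (Phi t%:E) => [p| |//]; last by rewrite addeNy leNye.
  rewrite -EFinM -EFinD !lee_fin => p0.
  have : (t * y <= M * `|y|)%R.
    by rewrite (le_trans (ler_norm _))// normrM ger0_norm// ler_wpM2r.
  lra.
have tT : (T < t)%R.
  by apply: lt_trans Mt; rewrite /M lt_max ltrDl ltr01.
have {}t0 : (0 < t)%R by apply: lt_trans Mt.
have := HT _ tT.
have := entropy_fin_num H t0; case: (Phi t%:E) => // p _.
rewrite -EFinM lee_fin ler_pdivlMr// mulrC => ytp _.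
rewrite -EFinM -EFinD lee_fin (@le_trans _ _ 0%R)//; last by rewrite mulr_ge0// ltW.
by rewrite subr_le0.
Qed.

(** The competitor [t = 1], where [Phi] vanishes. This linear minorant is the source of the
    integrable lower bounds for [psi] of the slack and of the integrable upper bounds for the
    potentials. *)
Lemma conjugate_lb (y : \bar R) : y <= conjugate Phi y.
Proof.
by apply: ereal_sup_ubound; exists 1 => //=; rewrite mul1e (entropy1 H) sube0.
Qed.

Lemma conjugate_EFin (y : R) : conjugate Phi y%:E = (psi y)%:E.
Proof.
rewrite /conjugate_real fineK// fin_numE.
have [M yM] := conjugate_ub y; have := conjugate_lb y%:E.
by case: (conjugate Phi y%:E) yM.
Qed.

Lemma conjugate_real_ge (y : R) : (y <= psi y)%R.
Proof. by rewrite -lee_fin -conjugate_EFin conjugate_lb. Qed.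

Lemma young (t y : R) : (t * y)%:E <= Phi t%:E + (psi y)%:E.
Proof.
have [t0|t0] := ltP t 0%R.
  by rewrite (entropy_lt0 H) ?lte_fin// addye// leey.
rewrite -conjugate_EFin.
have : t%:E * y%:E - Phi t%:E <= conjugate Phi y%:E.
  by apply: ereal_sup_ubound; exists t%:E.
have := entropy_ge0 H t%:E; rewrite conjugate_EFin.
case: (Phi t%:E) => [p _|_ _|//]; last by rewrite addye// leey.
by rewrite -EFinM -EFinD !lee_fin lerBlDl.
Qed.

Lemma conjugate_near_max (y d : R) : (0 < d)%R ->
  exists2 t : R, (0 <= t)%R & Phi t%:E <= (t * y - psi y + d)%:E.
Proof.
move=> d0; have : (psi y - d)%:E < conjugate Phi y%:E.
  by rewrite conjugate_EFin lte_fin ltrBlDr ltrDl.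
move=> /ereal_sup_gt [_ [t /= t0 <-]].
case: t t0 => [t|_|//]; last first.
  by rewrite (entropy_pinfty H) /= addeNy ltNge leNye.
rewrite lee_fin => t0.
have := entropy_ge0 H t%:E.
case E : (Phi t%:E) => [p| |//]; last by rewrite addeNy ltNge leNye.
rewrite -EFinM -EFinD lte_fin => _ h; exists t => //; rewrite E lee_fin; lra.
Qed.

Lemma conjugate_real0 : psi 0 = 0%R.
Proof.
apply/eqP; rewrite eq_le conjugate_real_ge andbT -lee_fin -conjugate_EFin.
apply: ge_ereal_sup => _ [t /= t0 <-].
by rewrite mule0 add0e oppe_le0 (entropy_ge0 H).
Qed.

Lemma conjugate_nondecreasing (y z : \bar R) : y <= z ->
  conjugate Phi y <= conjugate Phi z.
Proof.
move=> yz; apply: ge_ereal_sup => _ [t /= t0 <-].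
apply: (@le_trans _ _ (t * z - Phi t)).
  by apply: leeB => //; apply: lee_wpmul2l.
by apply: ereal_sup_ubound; exists t.
Qed.

Lemma conjugate_real_nondecreasing : {homo psi : y z / (y <= z)%R}.
Proof.
by move=> y z yz; rewrite -lee_fin -!conjugate_EFin conjugate_nondecreasing.
Qed.

End conjugate_of_entropy.

(** * Derivative of the conjugate and equality in Young's inequality *)

Section conjugate_derivative.
Context {R : realType}.
Variable Phi : \bar R -> \bar R.
Hypothesis H : is_entropy Phi.
Hypothesis Hd : forall y : R, derivable (conjugate_real Phi) y 1%R.
Local Notation psi := (conjugate_real Phi).
Local Notation dpsi := ((conjugate_real Phi)^`()%classic).

Lemma conjugate_quotient_cvg (y : R) :
  (h^-1 * (psi (y + h) - psi y))%R @[h --> 0%R^'] --> dpsi y.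
Proof.
have := @Hd y; rewrite /derivable derive1E /derive.
set f := (fun h => _); set g := (fun h : R => _ : R) => cf.
have -> : g = f; last exact: cf.
by apply/funext => h; rewrite /g /f /= -[_%:A]/(h * 1)%R mulr1 [(h + y)%R]addrC.
Qed.

Lemma conjugate_quotient_near (y e : R) : (0 < e)%R ->
  exists2 h0 : R, (0 < h0)%R & forall h : R, h != 0%R -> (`|h| <= h0)%R ->
    (`|h^-1 * (psi (y + h) - psi y) - dpsi y| <= e)%R.
Proof.
move=> e0; have := @conjugate_quotient_cvg y => /cvgrPdist_le /(_ _ e0).
move=> [r /= r0 hr]; exists (r / 2)%R; first by rewrite divr_gt0.
move=> h h0 hr2; rewrite distrC; apply: hr => //=.
rewrite sub0r normrN; lra.
Qed.


(** The inequality is tested only at [h0] and [- h0], where the difference quotients are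
    [e / 2]-close to [dpsi y]; the defect [d = h0 * (e / 2)] costs another [e / 2] after division by
    [h0]. *)
Lemma approx_subgradient (y e : R) : (0 < e)%R ->
  exists2 d : R, (0 < d)%R & forall t : R,
    (forall h : R, t * h - d <= psi (y + h) - psi y)%R ->
    (`|t - dpsi y| <= e)%R.
Proof.
move=> e0; have e20 : (0 < e / 2)%R by rewrite divr_gt0.
have [h0 h00 hh] := @conjugate_quotient_near y _ e20.
exists (h0 * (e / 2))%R => [|t ht]; first by rewrite mulr_gt0.
have h0N0 : h0 != 0%R by rewrite gt_eqF.
have := hh h0 h0N0; rewrite gtr0_norm// lexx => /(_ isT); rewrite ler_norml.
have := hh (- h0)%R; rewrite oppr_eq0 normrN gtr0_norm// lexx => /(_ h0N0 isT).
rewrite ler_norml => /andP[A1 A2] /andP[B1 B2].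
have := ht h0; have := ht (- h0)%R.
set p := (psi (y + h0) - _)%R in B1 B2 *; set q := (psi (y - h0) - _)%R in A1 A2 *.
move=> tq tp.
have tp' : (t - e / 2 <= h0^-1 * p)%R by rewrite ler_pdivlMl//; lra.
have tq' : ((- h0)^-1 * q <= t + e / 2)%R.
  by rewrite invrN mulNr lerNl ler_pdivlMl//; lra.
rewrite ler_norml; apply/andP; split; lra.
Qed.

(* Near-maximizers of [t * y - Phi t] converge to [dpsi y] because [psi] is
   derivable at [y]; lower semicontinuity then yields the attainment without a
   compactness argument. *)
Lemma fenchel_le (y : R) : Phi (dpsi y)%:E <= (dpsi y * y - psi y)%:E.
Proof.
rewrite leNgt; apply/negP.
set a := (_ - _)%R => aPhi.
have [a' aa' a'Phi] : exists2 a' : R, (a < a')%R & a'%:E < Phi (dpsi y)%:E.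
  move: aPhi; case: (Phi _) => [p| |//]; last first.
    by exists (a + 1)%R; [rewrite ltrDl|rewrite ltry].
  rewrite lte_fin => ap; exists ((a + p) / 2)%R; rewrite ?lte_fin; lra.
have [V nV VPhi] := entropy_lsc H a'Phi.
have /nbhs_ballP[r /= r0 rV] : nbhs (dpsi y) (EFin @^-1` V).
  exact: (nbhs_EFin V (dpsi y)).1.
(* The first bound keeps [t] in the neighbourhood where [Phi > a']. The second makes
   [(t - dpsi y) * y] at most half of the gap [a' - a]; the other half is spent on [d']. *)
pose e := (Num.min (r / 2) ((a' - a) / 2 / (`|y| + 1)))%R.
have y1 : (0 < `|y| + 1)%R by rewrite ltr_wpDl.
have e0 : (0 < e)%R by rewrite lt_min !divr_gt0// subr_gt0.
have [d d0 hd] := @approx_subgradient y e e0.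
pose d' := (Num.min d ((a' - a) / 2))%R.
have d'0 : (0 < d')%R by rewrite lt_min d0/= divr_gt0// subr_gt0.
have [t t0 ht] := conjugate_near_max H y d'0.
have d'd : (d' <= d)%R by rewrite ge_min lexx.
have d'a : (d' <= (a' - a) / 2)%R by rewrite ge_min lexx orbT.
have te : (`|t - dpsi y| <= e)%R.
  apply: hd => h; have := young H t (y + h).
  have := entropy_ge0 H t%:E.
  move: ht; case: (Phi t%:E) => // p; rewrite -EFinD !lee_fin.
  rewrite mulrDr; lra.
have er : (e <= r / 2)%R by rewrite ge_min lexx.
have /VPhi : V t%:E.
  by apply: (rV t); rewrite /ball/= distrC; apply: le_lt_trans te _; lra.
apply/negP; rewrite -leNgt; apply: le_trans ht _; rewrite lee_fin.
have : ((t - dpsi y) * y <= (a' - a) / 2)%R.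
  apply: le_trans (ler_norm _) _; rewrite normrM.
  apply: (@le_trans _ _ (e * (`|y| + 1)))%R.
    by apply: ler_pM => //; rewrite lerDl.
  by rewrite -ler_pdivlMr// ge_min lexx orbT.
rewrite /a mulrBl; rewrite /a in d'a; lra.
Qed.

Lemma fenchel_eq (y : R) : Phi (dpsi y)%:E = (dpsi y * y - psi y)%:E.
Proof.
apply/eqP; rewrite eq_le fenchel_le/=.
have := young H (dpsi y) y; have := fenchel_le y; have := entropy_ge0 H (dpsi y)%:E.
by case: (Phi _) => [p _ _| |//]//; rewrite -EFinD !lee_fin lerBlDr.
Qed.

(** Equality in Young's inequality makes [t] an exact subgradient of [psi] at [y], so it lies within
    every [e] of [dpsi y]. The uniqueness of the minimizer rests on this: derivability of [psi] does
    the work of strict convexity of [Phi]. *)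
Lemma fenchel_eq_unique (t y : R) :
  Phi t%:E <= (t * y - psi y)%:E -> t = dpsi y.
Proof.
move=> ht; apply/eqP; rewrite -subr_eq0 -normr_le0; apply/ler_addgt0Pr => e e0.
rewrite add0r; have [d d0 hd] := @approx_subgradient y e e0.
apply: hd => h; have := young H t (y + h); have := entropy_ge0 H t%:E.
move: ht; case: (Phi t%:E) => // p; rewrite -EFinD !lee_fin mulrDr; lra.
Qed.

Lemma subgradient (y z : R) : (dpsi y * (z - y) <= psi z - psi y)%R.
Proof.
by have := young H (dpsi y) z; rewrite fenchel_eq -EFinD lee_fin mulrBr; lra.
Qed.

Lemma conjugate_deriv_nondecreasing : {homo dpsi : y z / (y <= z)%R}.
Proof.
move=> y z; rewrite le_eqVlt => /predU1P[->//|yz].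
have zy0 : (0 < z - y)%R by rewrite subr_gt0.
rewrite -(ler_pM2r zy0); have := subgradient y z; have := subgradient z y.
by move: (dpsi y : R) (dpsi z : R) (psi y) (psi z) => p q s t; lra.
Qed.

Lemma conjugate_deriv_ge0 (y : R) : (0 <= dpsi y)%R.
Proof.
have := @subgradient y (y - 1)%R.
have : (psi (y - 1) <= psi y)%R by apply: conjugate_real_nondecreasing => //; lra.
lra.
Qed.

(** Young's inequality at the fixed point [t = |K| + 1] and the subgradient inequality towards [0]
    give [t * y - Phi t <= psi y <= dpsi y * y]; once [y >= Phi t] the slope is at least [t - 1]. *)
Lemma conjugate_deriv_unbounded (K : R) : exists2 y0 : R, (0 < y0)%R &
  forall y, (y0 <= y)%R -> (K <= dpsi y)%R.
Proof.
pose t := (`|K| + 1)%R.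
have t0 : (0 < t)%R by rewrite ltr_wpDl.
have := entropy_fin_num H t0; have := entropy_ge0 H t%:E.
case E : (Phi t%:E) => [p| |]// p0 _; rewrite lee_fin in p0.
exists (p + 1)%R => [|y py]; first by rewrite ltr_wpDl.
have y0 : (0 < y)%R by lra.
have := young H t y; rewrite E -EFinD lee_fin.
have := @subgradient y 0%R; rewrite (conjugate_real0 H) => h1 h2.
have tK : (t * y - p <= dpsi y * y)%R by lra.
have : ((t - 1) * y <= dpsi y * y)%R by lra.
by rewrite ler_pM2r// /t addrK; apply: le_trans; exact: ler_norm.
Qed.

(** The same comparison with [t = 1 / 4], at a [y] so negative that [Phi t <= - y / 4]. What counts
    later is a slope strictly below [1], so that a density equal to it cannot restore a full
    marginal. *)
Lemma conjugate_deriv_small : exists y0 : R, (dpsi y0 <= 1 / 2)%R.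
Proof.
have t0 : (0 < 4^-1 :> R)%R by rewrite invr_gt0.
have := entropy_fin_num H t0; have := entropy_ge0 H (4^-1 : R)%:E.
case E : (Phi _) => [p| |]// p0 _; rewrite lee_fin in p0.
exists (- (4 * (p + 1)))%R; set y := (- _)%R.
have := young H 4^-1 y; rewrite E -EFinD lee_fin => h1.
have := @subgradient y 0%R; rewrite (conjugate_real0 H) => h2.
have y0 : (y <= - 4)%R by rewrite /y; lra.
have yp : (p <= - y / 4)%R by rewrite /y; lra.
have : (dpsi y * - y <= 1 / 2 * - y)%R by lra.
by rewrite ler_pM2r//; lra.
Qed.

(** Exhibits the conjugate as a combination of measurable functions of an extended real. The maximum
    matters only at [-oo], where [er_map] returns [-oo]; at a real [y] monotonicity gives
    [psi y >= - Phi 0]. *)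
Lemma conjugateE : conjugate Phi = (fun y => maxe (- Phi 0) (er_map psi y)).
Proof.
have cNy : conjugate Phi -oo = - Phi 0.
  apply/eqP; rewrite eq_le; apply/andP; split.
    apply: ge_ereal_sup => _ [t /= t0 <-].
    have [->|tN0] := eqVneq t 0; first by rewrite mul0e add0e.
    by rewrite gt0_muleNy ?lt0e ?tN0// addNye leNye.
  by apply: ereal_sup_ubound; exists 0 => //=; rewrite mul0e add0e.
apply/funext => -[y| |] /=.
- rewrite -(conjugate_EFin H); apply/esym/max_idPr; rewrite -cNy.
  by apply: conjugate_nondecreasing; rewrite leNye.
- rewrite maxey; apply/eqP; rewrite eq_le leey/=.
  exact: (conjugate_lb H).
- by rewrite maxeNy.
Qed.

Lemma measurable_conjugate_real : measurable_fun [set: R] psi.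
Proof.
exact: (nondecreasing_measurable measurableT (conjugate_real_nondecreasing H)).
Qed.

Lemma measurable_conjugate : measurable_fun [set: \bar R] (conjugate Phi).
Proof.
rewrite conjugateE; apply: measurable_maxe => //.
exact: (measurable_er_map R measurable_conjugate_real).
Qed.

Lemma measurable_conjugate_deriv : measurable_fun [set: R] dpsi.
Proof.
exact: (nondecreasing_measurable measurableT conjugate_deriv_nondecreasing).
Qed.

Lemma conjugate'E : conjugate' Phi = (fun y => maxe 0 (er_map dpsi y)).
Proof.
apply/funext => -[y| |] /=; rewrite ?maxey ?maxeNy//.
by apply/esym/max_idPr; rewrite lee_fin conjugate_deriv_ge0.
Qed.

Lemma measurable_conjugate' : measurable_fun [set: \bar R] (conjugate' Phi).
Proof.
rewrite conjugate'E; apply: measurable_maxe => //.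
exact: (measurable_er_map R measurable_conjugate_deriv).
Qed.

Lemma measurable_entropy : measurable_fun [set: R] (Phi \o EFin).
Proof.
apply: lower_semicontinuous_measurable => x a /= /(entropy_lsc H)[V nV VPhi].
by exists (EFin @^-1` V) => [|y]; [exact: (nbhs_EFin V x).1|exact: VPhi].
Qed.

End conjugate_derivative.

(** * Integration lemmas *)

Section integration.
Context {R : realType} d {T : measurableType d} (mu : {measure set T -> \bar R}).

Lemma integrable_between (f g h : T -> R) : measurable_fun setT f ->
  (forall x, g x <= f x <= h x)%R ->
  mu.-integrable setT (EFin \o g) -> mu.-integrable setT (EFin \o h) ->
  mu.-integrable setT (EFin \o f).
Proof.
move=> mf gfh ig ih.
apply: (@le_integrable _ _ _ mu _ measurableT _
  ((EFin \o (fun x => `|g x|%R)) \+ (EFin \o (fun x => `|h x|%R)))).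
- exact/measurable_EFinP.
- move=> x _ /=; rewrite lee_fin [leRHS]ger0_norm ?addr_ge0//.
  have /andP[gf fh] := gfh x.
  rewrite ler_norml; have := ler_norm (h x).
  have := normr_ge0 (g x); have := normr_ge0 (h x).
  have : (- `|g x| <= g x)%R by rewrite lerNl -normrN ler_norm.
  lra.
- by apply: integrableD => //; exact: integrable_norm.
Qed.

Lemma integrable_addr (f g : T -> R) :
  mu.-integrable setT (EFin \o f) -> mu.-integrable setT (EFin \o g) ->
  mu.-integrable setT (EFin \o (fun x => f x + g x)%R).
Proof.
by move=> fi gi; exact: (@integrableD _ _ _ mu setT measurableT _ _ fi gi).
Qed.

Lemma integrable_subr (f g : T -> R) :
  mu.-integrable setT (EFin \o f) -> mu.-integrable setT (EFin \o g) ->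
  mu.-integrable setT (EFin \o (fun x => f x - g x)%R).
Proof.
by move=> fi gi; exact: (@integrableB _ _ _ mu setT measurableT _ _ fi gi).
Qed.

Lemma integrable_mulr (c : R) (f : T -> R) :
  mu.-integrable setT (EFin \o f) ->
  mu.-integrable setT (EFin \o (fun x => c * f x)%R).
Proof. by move=> fi; exact: (@integrableZl _ _ _ mu setT measurableT c _ fi). Qed.

Lemma fatou_le (f_ : (T -> \bar R)^nat) (f : T -> \bar R) (C : \bar R) :
  (forall n, measurable_fun setT (f_ n)) -> (forall n x, 0 <= f_ n x) ->
  (forall x, f_ ^~ x @ \oo --> f x) ->
  (forall n, \int[mu]_x f_ n x <= C) -> \int[mu]_x f x <= C.
Proof.
move=> mf f0 ff fC.
rewrite (eq_integral (fun x => limn_einf (f_ ^~ x))); last first.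
  by move=> x _; rewrite (cvg_limn_einf_sup (ff x)).1.
apply: le_trans (fatou mu measurableT mf (fun n x _ => f0 n x)) _.
rewrite limn_einf_lim; apply: lime_le; first exact: is_cvg_einfs.
apply: nearW => n; apply: le_trans (fC n).
by apply: ereal_inf_lbound; exists n => /=.
Qed.

Lemma le_integral_EFin (f g : T -> R) :
  mu.-integrable setT (EFin \o f) -> mu.-integrable setT (EFin \o g) ->
  (forall x, f x <= g x)%R -> \int[mu]_x (f x)%:E <= \int[mu]_x (g x)%:E.
Proof. by move=> *; apply: le_integral => // x _; rewrite lee_fin. Qed.

Lemma integral_mkindic (A : set T) (f : T -> R) :
  \int[mu]_(x in A) (f x)%:E = \int[mu]_x (\1_A x * f x)%:E.
Proof.
rewrite integral_mkcond; apply: eq_integral => x _.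
by rewrite patchE indicE; case: ifPn; rewrite ?mul1r ?mul0r.
Qed.

End integration.

(** * Change of variables along a map with prescribed image measure *)

Section marginal.
Context {R : realType} d d' {T : measurableType d} {Z : measurableType d'}.
Variables (mu : {measure set T -> \bar R}) (rho : {measure set Z -> \bar R}).
Variable p : T -> Z.
Hypothesis mp : measurable_fun [set: T] p.
Hypothesis murho : forall A, measurable A -> mu (p @^-1` A) = rho A.

Lemma integrable_marginal (f : Z -> \bar R) :
  rho.-integrable setT f -> mu.-integrable setT (f \o p).
Proof.
move=> /integrableP[mf foo]; apply/integrableP; split.
  exact: measurableT_comp.
apply: le_lt_trans foo; rewrite [leRHS](eq_measure_integral (pushforward mu p)).
  by rewrite [leRHS]ge0_integral_pushforward//; exact: measurableT_comp.
by move=> A mA _; rewrite /pushforward -murho.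
Qed.

Lemma integral_marginal (f : Z -> \bar R) : rho.-integrable setT f ->
  \int[mu]_x f (p x) = \int[rho]_z f z.
Proof.
move=> fi; rewrite [RHS](eq_measure_integral (pushforward mu p)); last first.
  by move=> A mA _; rewrite /pushforward -murho.
have [mf _] := integrableP _ _ _ fi.
by rewrite (integral_pushforward mp mf)//; exact: integrable_marginal.
Qed.

Lemma ae_marginal (P : Z -> Prop) :
  {ae rho, forall z, P z} -> {ae mu, forall x, P (p x)}.
Proof.
move=> [N [mN N0 PN]]; exists (p @^-1` N); split.
- by rewrite -[X in measurable X]setTI; exact: mp.
- by rewrite murho.
- by move=> x /=; exact: PN.
Qed.

End marginal.

(** * Integrability criteria and probabilities given by a density *)

Section integrability.
Context {R : realType} d {T : measurableType d} (mu : probability T R).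

Let integrable_parts (f : T -> \bar R) : measurable_fun setT f ->
  \int[mu]_x f^\+ x < +oo -> \int[mu]_x f^\- x < +oo ->
  mu.-integrable setT f.
Proof.
move=> mf fP fN.
rewrite (funeposneg f); apply: integrableB => //; apply/integrableP; split.
- exact: measurable_funepos.
- by under eq_integral do rewrite gee0_abs//.
- exact: measurable_funeneg.
- by under eq_integral do rewrite gee0_abs//.
Qed.

Lemma fin_num_integrable (f : T -> \bar R) : measurable_fun setT f ->
  \int[mu]_x f x \is a fin_num -> mu.-integrable setT f.
Proof.
move=> mf; rewrite integralE fin_numB => /andP[fP fN].
by apply: integrable_parts; rewrite // ltey_eq ?fP ?fN.
Qed.

(* The value [+oo - +oo = -oo] of an undefined integral is excluded by the
   one-sided bound. *)
Lemma integrable_ge (f g : T -> \bar R) : measurable_fun setT f ->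
  mu.-integrable setT g -> (forall x, g x <= f x) ->
  \int[mu]_x f x < +oo -> mu.-integrable setT f.
Proof.
move=> mf ig gf; rewrite integralE => f_oo.
have mg : measurable_fun setT g by exact: (measurable_int mu).
have fN : \int[mu]_x f^\- x < +oo.
  apply: le_lt_trans (integral_funeneg_lt_pinfty measurableT ig).
  apply: ge0_le_integral => //; try exact: measurable_funeneg.
  by move=> x _; apply: (@funeneg_le _ _ setT g f) => [y _|]; rewrite ?inE.
have fN0 : 0 <= \int[mu]_x f^\- x by apply: integral_ge0.
apply: integrable_parts => //.
move: f_oo fN fN0; case: (\int[mu]_x f^\- x) => // r.
by case: (\int[mu]_x f^\+ x) => // s *; rewrite ltry.
Qed.

Lemma integrable_le (f g : T -> \bar R) : measurable_fun setT f ->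
  mu.-integrable setT g -> (forall x, f x <= g x) ->
  -oo < \int[mu]_x f x -> mu.-integrable setT f.
Proof.
move=> mf ig fg; rewrite integralE => f_oo.
have mg : measurable_fun setT g by exact: (measurable_int mu).
have fP : \int[mu]_x f^\+ x < +oo.
  apply: le_lt_trans (integral_funepos_lt_pinfty measurableT ig).
  apply: ge0_le_integral => //; try exact: measurable_funepos.
  by move=> x _; apply: (@funepos_le _ _ setT f g) => [y _|]; rewrite ?inE.
have fP0 : 0 <= \int[mu]_x f^\+ x by apply: integral_ge0.
apply: integrable_parts => //.
move: f_oo fP fP0; case: (\int[mu]_x f^\+ x) => // r.
by case: (\int[mu]_x f^\- x) => // s *; rewrite ltry.
Qed.

Lemma ae_eq_integrable (f g : T -> \bar R) : measurable_fun setT g ->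
  {ae mu, forall x, f x = g x} ->
  mu.-integrable setT f -> mu.-integrable setT g.
Proof.
move=> mg fg /integrableP[mf foo]; apply/integrableP; split => //.
rewrite -(ge0_ae_eq_integral (f := fun x => `|f x|)) //.
- exact: measurableT_comp.
- exact: measurableT_comp.
- by apply: filterS fg => x -> _.
Qed.

Lemma bounded_integrable (f : T -> R) (K : R) : measurable_fun setT f ->
  (forall x, `|f x| <= K)%R -> mu.-integrable setT (EFin \o f).
Proof.
move=> mf fK; apply: measurable_bounded_integrable => //.
  by rewrite [X in X < _]probability_setT ltry.
exists K; split; first exact: num_real.
by move=> M KM x _; apply: le_trans (fK x) (ltW KM).
Qed.

(** Turns the set function [gamma_star], a mere integral, into an object of the type over which
    couplings range. *)
Lemma probability_of_density (f : T -> R) : (forall x, 0 <= f x)%R ->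
  mu.-integrable setT (EFin \o f) -> \int[mu]_x (f x)%:E = 1 ->
  exists g : probability T R,
    forall A, measurable A -> g A = \int[mu]_(x in A) (f x)%:E.
Proof.
move=> f0 fi f1.
have pos E : 0 <= induced_charge fi E.
  by apply: integral_ge0 => x _; rewrite lee_fin.
pose m : {measure set T -> \bar R} := measure_of_charge (induced_charge fi) pos.
have m1 : m setT = 1 by [].
pose mixin := Measure_isProbability.Build _ _ _ m m1.
pose g : probability T R := HB.pack (m : set T -> \bar R) m mixin.
by exists g.
Qed.

End integrability.

(** * First-order conditions for one potential *)

Section one_sided_optimality.
Context {R : realType} (Phi : \bar R -> \bar R).
Hypothesis H : is_entropy Phi.
Hypothesis Hd : forall y : R, derivable (conjugate_real Phi) y 1%R.
Local Notation psi := (conjugate_real Phi).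
Local Notation dpsi := ((conjugate_real Phi)^`()%classic).

Lemma conjugate_quotient_seq (y : R) (h : R^nat) :
  (forall n, h n != 0%R) -> (forall n, `|h n| <= n.+1%:R^-1)%R ->
  ((h n)^-1 * (psi (y + h n) - psi y))%R @[n --> \oo] --> dpsi y.
Proof.
move=> h0 hn; apply/cvgrPdist_le => e e0.
have [r r0 hr] := conjugate_quotient_near Hd y e0.
near=> n; rewrite distrC; apply: hr => //.
apply: le_trans (hn n) _; apply/ltW; near: n.
exact: (near_infty_natSinv_lt (PosNum r0)).
Unshelve. all: by end_near. Qed.

Context d d' {T : measurableType d} {Z : measurableType d'}.
Variables (mu : probability T R) (rho : probability Z R) (p : T -> Z).
Hypothesis mp : measurable_fun [set: T] p.
Hypothesis murho : forall A, measurable A -> mu (p @^-1` A) = rho A.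
Variables (a : Z -> R) (S : T -> R).
Hypothesis ma : measurable_fun setT a.
Hypothesis iS : mu.-integrable setT (EFin \o S).
Hypothesis ipa : rho.-integrable setT (EFin \o (psi \o a)).
Hypothesis ipa0 : 0 < \int[rho]_z (psi (a z))%:E.
Hypothesis ipS : mu.-integrable setT (EFin \o (psi \o S)).
(** Optimality of [a] with the other potential frozen. Here [p] stands for either projection and [S]
    for the slack, so that both potentials are treated at once; [h] ranges only over bounded
    perturbations that leave every integral meaningful and the perturbed potential in the admissible
    class. *)
Hypothesis opt : forall h : Z -> R, measurable_fun setT h ->
  (exists M : R, forall z, (`|h z| <= M)%R) ->
  rho.-integrable setT (EFin \o (fun z => psi (a z + h z)%R)) ->
  0 < \int[rho]_z (psi (a z + h z)%R)%:E ->
  mu.-integrable setT (EFin \o (fun x => psi (S x + h (p x))%R)) ->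
  \int[rho]_z (h z)%:E <= \int[mu]_x (psi (S x + h (p x)) - psi (S x))%:E.

Let mS : measurable_fun setT S.
Proof. by apply/measurable_EFinP; have [] := integrableP _ _ _ iS. Qed.

Let mpsi (d0 : measure_display) (U : measurableType d0) (f : U -> R) :
  measurable_fun setT f -> measurable_fun setT (psi \o f).
Proof. exact: measurableT_comp (measurable_conjugate_real H). Qed.

Let mindic_p (A : set Z) :
  measurable A -> measurable_fun setT (fun x => \1_A (p x) : R).
Proof. by move=> mA; exact: measurableT_comp. Qed.

(** The perturbation [s * \1_A] in [opt]. The factor [s] stays on both sides because its sign
    decides the direction of the inequality: a negative [s] yields an upper bound on the quotients,
    a positive one a lower bound. *)
Lemma variation_quotient (A : set Z) (s : R) : measurable A -> s != 0%R ->
  rho.-integrable setT (EFin \o (fun z => psi (a z + s * \1_A z)%R)) ->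
  0 < \int[rho]_z (psi (a z + s * \1_A z)%R)%:E ->
  mu.-integrable setT (EFin \o (fun x => psi (S x + s * \1_A (p x))%R)) ->
  s%:E * rho A <=
  s%:E * \int[mu]_x (s^-1 * (psi (S x + s * \1_A (p x)) - psi (S x)))%:E.
Proof.
move=> mA s0 i1 p1 i2.
have -> : s%:E * rho A = \int[rho]_z (s * \1_A z)%:E.
  under eq_integral do rewrite EFinM.
  by rewrite integralZl//= ?integral_indic ?setIT//; exact: integrable_indic.
have iF : mu.-integrable setT
    (EFin \o (fun x => psi (S x + s * \1_A (p x)) - psi (S x))%R).
  exact: integrable_subr.
under [in leRHS]eq_integral do rewrite EFinM.
rewrite (integralZl measurableT iF) muleA -EFinM mulfV// mul1e.
apply: opt => //.
  by apply: measurable_funM => //.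
exists `|s|%R => z; rewrite normrM indicE.
by case: (_ \in _); rewrite /= ?normr1 ?normr0 ?mulr1 ?mulr0.
Qed.

(** For the perturbation [- dn * \1_A] the quotients are nonnegative by monotonicity of [psi] and
    tend to [\1_A * dpsi S]. The bound on [a] over [A] limits the decrease of [psi a] there, which
    keeps the perturbed potential admissible. *)
Lemma marginal_le (A : set Z) (N : R) : measurable A ->
  (forall z, A z -> a z <= N)%R ->
  \int[mu]_x (\1_A (p x) * dpsi (S x))%:E <= rho A.
Proof.
move=> mA aN.
have I_fin : \int[rho]_z (psi (a z))%:E \is a fin_num.
  exact: (integrable_fin_num measurableT ipa).
set I := fine (\int[rho]_z (psi (a z))%:E).
have I0 : (0 < I)%R by rewrite /I fine_gt0// ipa0 ltey_eq I_fin.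
pose L := dpsi N.
have L0 : (0 <= L)%R by exact: conjugate_deriv_ge0.
(* On [A] the slope of [psi] at [a] is at most [L], so a decrease by [d0] lowers the integral of
   [psi a] by at most [L * d0 < I], and it remains positive. The [+ 1] covers the case [L = 0]. *)
pose d0 := (Num.min 1 (I / (2 * (L + 1))))%R.
have d00 : (0 < d0)%R.
  by rewrite lt_min ltr01 divr_gt0// mulr_gt0// ltr_wpDl.
have d01 : (d0 <= 1)%R by rewrite ge_min lexx.
have Ld0 : (L * d0 < I)%R.
  apply: (@le_lt_trans _ _ (L * (I / (2 * (L + 1)))))%R.
    by rewrite ler_wpM2l// ge_min lexx orbT.
  rewrite mulrA ltr_pdivrMr; last by rewrite mulr_gt0// ltr_wpDl.
  nra.
pose dn (n : nat) := (d0 / n.+1%:R)%R.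
have dn0 n : (0 < dn n)%R by rewrite divr_gt0.
have dnd0 n : (dn n <= d0)%R.
  by rewrite ler_pdivrMr// ler_peMr ?ler1n ?ltW.
have dnn n : (dn n <= n.+1%:R^-1)%R by rewrite ler_piMl.
apply: (@fatou_le _ _ _ mu (fun n x =>
  ((- dn n)^-1 * (psi (S x + - dn n * \1_A (p x)) - psi (S x)))%:E)).
- move=> n; apply/measurable_EFinP; apply: measurable_funM => //.
  apply: measurable_funB; last exact: mpsi.
  apply: mpsi; apply: measurable_funD => //.
  by apply: measurable_funM => //; exact: mindic_p.
- move=> n x; rewrite lee_fin invrN mulNr -mulrN opprB.
  apply: mulr_ge0; first by rewrite invr_ge0 ltW.
  rewrite subr_ge0 (conjugate_real_nondecreasing H)// gerDl mulNr oppr_le0.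
  by rewrite mulr_ge0// ltW.
- move=> x; apply: cvg_EFin; first exact: nearW.
  rewrite (_ : _ \o _ = (fun n =>
    (- dn n)^-1 * (psi (S x + - dn n * \1_A (p x)) - psi (S x)))%R)//.
  rewrite indicE; case: (_ \in _) => /=.
    rewrite mul1r; under eq_fun do rewrite mulr1.
    apply: conjugate_quotient_seq => n; first by rewrite oppr_eq0 gt_eqF.
    by rewrite normrN gtr0_norm.
  rewrite mul0r; under eq_fun do rewrite mulr0 addr0 subrr mulr0.
  exact: cvg_cst.
- move=> n.
  have le_psi_a z :
      (psi (a z) - L * dn n <= psi (a z + - dn n * \1_A z) <= psi (a z))%R.
    have Ldn : (0 <= L * dn n)%R by rewrite mulr_ge0// ltW.
    rewrite indicE; have [zA|zA] := boolP (z \in A); last first.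
      by rewrite mulr0 addr0 lexx andbT; lra.
    rewrite mulr1; apply/andP; split; last first.
      by rewrite (conjugate_real_nondecreasing H)//; have := dn0 n; lra.
    have := subgradient H Hd (a z) (a z + - dn n)%R.
    have : (dpsi (a z) * dn n <= L * dn n)%R.
      apply: ler_wpM2r; first exact: ltW.
      by apply: (conjugate_deriv_nondecreasing H Hd); apply: aN; rewrite inE in zA.
    lra.
  have iL : rho.-integrable setT (EFin \o (fun z => psi (a z) - L * dn n)%R).
    apply: (integrable_subr ipa).
    exact: finite_measure_integrable_cst.
  have i1 : rho.-integrable setT (EFin \o (fun z => psi (a z + - dn n * \1_A z)%R)).
    apply: (integrable_between _ le_psi_a iL ipa).
    apply: mpsi; apply: measurable_funD => //.
    exact: measurable_funM.
  (* No slope bound is available for [S], whose other potential may be unbounded above; the minorant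
     [psi y >= y] supplies the integrable lower bound [S - dn] instead. *)
  have i2 : mu.-integrable setT (EFin \o (fun x => psi (S x + - dn n * \1_A (p x))%R)).
    apply: (@integrable_between _ _ _ mu _ (fun x => S x - dn n)%R (psi \o S)).
    - apply: mpsi; apply: measurable_funD => //.
      by apply: measurable_funM => //; exact: mindic_p.
    - move=> x /=; have dnn0 := dn0 n.
      have i01 : (0 <= (\1_A (p x) : R) <= 1)%R.
        by rewrite indicE; case: (_ \in _); rewrite /= ?lexx ?ler01.
      have di : (0 <= dn n * \1_A (p x) <= dn n)%R.
        by case/andP: i01 => i0 i1'; rewrite mulr_ge0 ?ler_piMr// ltW.
      apply/andP; split.
        by apply: le_trans (conjugate_real_ge H _); lra.
      by rewrite (conjugate_real_nondecreasing H)//; lra.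
    - apply: (integrable_subr iS).
      exact: finite_measure_integrable_cst.
    - exact: ipS.
  have p1 : 0 < \int[rho]_z (psi (a z + - dn n * \1_A z)%R)%:E.
    apply: (@lt_le_trans _ _ (\int[rho]_z (psi (a z) - L * dn n)%:E)); last first.
      by apply: le_integral_EFin => // z; have /andP[] := le_psi_a z.
    under eq_integral do rewrite EFinB.
    rewrite (integralB_EFin measurableT ipa); last first.
      exact: finite_measure_integrable_cst.
    rewrite integral_cst// [X in _ * X]probability_setT mule1 -(fineK I_fin) -/I.
    rewrite -EFinB lte_fin subr_gt0; apply: le_lt_trans Ld0.
    by rewrite ler_wpM2l.
  have sn0 : (- dn n)%R != 0%R by rewrite oppr_eq0 gt_eqF.
  have := variation_quotient mA sn0 i1 p1 i2.
  by rewrite EFinN !mulNe leeN2 lee_pmul2l ?lte_fin.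
Qed.

Lemma marginal_ge (A : set Z) (K : R) : measurable A ->
  (forall z, a z <= K)%R -> (forall x, S x <= K)%R ->
  rho A <= \int[mu]_x (\1_A (p x) * dpsi (S x))%:E.
Proof.
move=> mA aK SK.
(* The increments are at most [1], so every argument of [psi] stays below [K + 1] and [L] dominates
   all the quotients. Positivity of the integral is preserved since [psi] is nondecreasing. *)
pose L := dpsi (K + 1).
have L0 : (0 <= L)%R by exact: conjugate_deriv_ge0.
pose dn (n : nat) := (n.+1%:R^-1 : R)%R.
have dn0 n : (0 < dn n)%R by rewrite invr_gt0.
have dn1 n : (dn n <= 1)%R by rewrite invf_le1// ler1n.
have quot (y : R) n (b : bool) : (y <= K)%R ->
    (psi y <= psi (y + dn n * b%:R) <= psi y + L * dn n)%R.
  move=> yK; have dnn0 := dn0 n; have dnn1 := dn1 n.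
  case: b => /=; last first.
    by rewrite mulr0 addr0 lexx lerDl mulr_ge0// ltW.
  rewrite mulr1; apply/andP; split.
    by rewrite (conjugate_real_nondecreasing H)//; lra.
  have := subgradient H Hd (y + dn n)%R y.
  have : (dpsi (y + dn n) * dn n <= L * dn n)%R.
    apply: ler_wpM2r; first exact: ltW.
    by apply: (conjugate_deriv_nondecreasing H Hd); lra.
  lra.
pose f_ n x := ((dn n)^-1 * (psi (S x + dn n * \1_A (p x)) - psi (S x)))%:E.
have [] := @dominated_convergence _ _ _ mu setT measurableT f_
    (fun x => (\1_A (p x) * dpsi (S x))%:E) (cst L%:E).
- move=> n; apply/measurable_EFinP; apply: measurable_funM => //.
  apply: measurable_funB; last exact: mpsi.
  apply: mpsi; apply: measurable_funD => //.
  by apply: measurable_funM => //; exact: mindic_p.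
- apply/measurable_EFinP; apply: measurable_funM; first exact: mindic_p.
  exact: measurableT_comp (measurable_conjugate_deriv H Hd) _.
- apply: aeW => x _; apply: cvg_EFin; first exact: nearW.
  rewrite (_ : _ \o _ = (fun n =>
    (dn n)^-1 * (psi (S x + dn n * \1_A (p x)) - psi (S x)))%R)//.
  rewrite indicE; case: (_ \in _) => /=.
    rewrite mul1r; under eq_fun do rewrite mulr1.
    apply: conjugate_quotient_seq => n; first by rewrite gt_eqF.
    by rewrite gtr0_norm.
  rewrite mul0r; under eq_fun do rewrite mulr0 addr0 subrr mulr0.
  exact: cvg_cst.
- exact: finite_measure_integrable_cst.
- apply: aeW => x n _; rewrite /f_ abse_EFin lee_fin indicE.
  have /andP[q1 q2] := quot (S x) n (p x \in A) (SK x).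
  rewrite ger0_norm ?mulr_ge0 ?invr_ge0 ?subr_ge0// ?(ltW (dn0 n))//.
  by rewrite ler_pdivrMl//; lra.
move=> _ _; apply: cvge_ge; apply: nearW => n; rewrite /f_.
have i1 : rho.-integrable setT (EFin \o (fun z => psi (a z + dn n * \1_A z)%R)).
  apply: (@integrable_between _ _ _ rho _ (psi \o a) (fun z => psi (a z) + L * dn n)%R).
  - by apply: mpsi; apply: measurable_funD => //; exact: measurable_funM.
  - by move=> z; rewrite indicE; exact: quot.
  - exact: ipa.
  - apply: (integrable_addr ipa).
    exact: finite_measure_integrable_cst.
have i2 : mu.-integrable setT (EFin \o (fun x => psi (S x + dn n * \1_A (p x))%R)).
  apply: (@integrable_between _ _ _ mu _ (psi \o S) (fun x => psi (S x) + L * dn n)%R).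
  - apply: mpsi; apply: measurable_funD => //.
    by apply: measurable_funM => //; exact: mindic_p.
  - by move=> z; rewrite indicE; exact: quot.
  - exact: ipS.
  - apply: (integrable_addr ipS).
    exact: finite_measure_integrable_cst.
have p1 : 0 < \int[rho]_z (psi (a z + dn n * \1_A z)%R)%:E.
  apply: lt_le_trans ipa0 _; apply: le_integral_EFin => // z.
  by rewrite indicE; have /andP[] := quot (a z) n (z \in A) (aK z).
have sn0 : dn n != 0%R by rewrite gt_eqF.
have := variation_quotient mA sn0 i1 p1 i2.
by rewrite lee_pmul2l ?lte_fin.
Qed.

End one_sided_optimality.

(** * Essential bounds drawn from the marginal inequalities *)

Section essential_bounds.
Context {R : realType} (Phi : \bar R -> \bar R).
Hypothesis H : is_entropy Phi.
Hypothesis Hd : forall y : R, derivable (conjugate_real Phi) y 1%R.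
Local Notation dpsi := ((conjugate_real Phi)^`()%classic).

Context d d' {T : measurableType d} {Z : measurableType d'}.
Variables (mu : probability T R) (rho : probability Z R) (p : T -> Z).
Hypothesis mp : measurable_fun [set: T] p.
Hypothesis murho : forall A, measurable A -> mu (p @^-1` A) = rho A.
Variables (a : Z -> R) (S : T -> R).
Hypothesis ma : measurable_fun setT a.
Hypothesis mS : measurable_fun setT S.

Let mindic_p (A : set Z) :
  measurable A -> measurable_fun setT (fun x => \1_A (p x) : R).
Proof. by move=> mA; exact: measurableT_comp. Qed.

Let mdpsi : measurable_fun setT (dpsi \o S).
Proof. exact: measurableT_comp (measurable_conjugate_deriv H Hd) _. Qed.

Let measurable_strip (K N : R) : measurable [set z | (K < a z <= N)%R].
Proof.
rewrite (_ : [set _ | _] = a @^-1` `]K, N]).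
  by rewrite -[X in measurable X]setTI; exact: ma.
by apply/seteqP; split=> z /=; rewrite in_itv.
Qed.

Let measurable_lt (K : R) : measurable [set z | (a z < K)%R].
Proof.
rewrite (_ : [set _ | _] = a @^-1` `]-oo, K[).
  by rewrite -[X in measurable X]setTI; exact: ma.
by apply/seteqP; split=> z /=; rewrite in_itv.
Qed.

Let measurable_preimage_p (A : set Z) : measurable A -> measurable (p @^-1` A).
Proof. by move=> mA; rewrite -[X in measurable X]setTI; exact: mp. Qed.

Lemma ae_upper_bound (B : set T) (w0 m0 : R) : measurable B -> (0 < m0)%R ->
  (forall A, measurable A -> m0%:E * rho A <= mu (p @^-1` A `&` B)) ->
  (forall x, B x -> a (p x) + w0 <= S x)%R ->
  (forall A N, measurable A -> (forall z, A z -> a z <= N)%R ->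
     \int[mu]_x (\1_A (p x) * dpsi (S x))%:E <= rho A) ->
  exists K : R, {ae rho, forall z, (a z <= K)%R}.
Proof.
move=> mB m00 muB BS le_rho.
have [y0 y00 hy0] := conjugate_deriv_unbounded H Hd (2 / m0)%R.
pose K := (y0 - w0)%R; exists K.
have strip0 n : rho.-negligible [set z | (K < a z <= n%:R)%R].
  apply/negligibleP => //; set A := [set z | _].
  have mA : measurable A by exact: measurable_strip.
  suff: rho A = 0 by [].
  have : 2%:E * rho A <= rho A.
    have /(le_trans _) := @le_rho A n%:R mA (fun z => fun h => (andP h).2).
    apply.
    rewrite (_ : 2%:E = (2 / m0)%:E * m0%:E)%E; last first.
      by rewrite -EFinM divfK// gt_eqF.
    rewrite -muleA.
    apply: (@le_trans _ _ ((2 / m0)%:E * mu (p @^-1` A `&` B))).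
      by apply: lee_wpmul2l; [rewrite lee_fin divr_ge0// ltW|exact: muB].
    have mAB : measurable (p @^-1` A `&` B).
      by apply: measurableI => //; exact: measurable_preimage_p.
    rewrite -[X in mu X]setIT -integral_indic// -ge0_integralZl_EFin//; last 2 first.
      exact/measurable_EFinP.
      by rewrite divr_ge0// ltW.
    apply: ge0_le_integral => //.
    - by move=> x _; rewrite -EFinM lee_fin mulr_ge0// divr_ge0// ltW.
    - by apply/measurable_EFinP; apply: measurable_funM.
    - by apply/measurable_EFinP; apply: measurable_funM => //; exact: mindic_p.
    move=> x _; rewrite -EFinM lee_fin !indicE in_setI.
    have -> : (x \in p @^-1` A) = (p x \in A) by apply/idP/idP; rewrite !inE.
    have [pA|pA] := boolP (p x \in A); last by rewrite mulr0 mul0r.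
    have [xB|xB] := boolP (x \in B) => /=; last first.
      by rewrite mulr0 mul1r conjugate_deriv_ge0.
    rewrite mulr1 mul1r; apply: hy0.
    move: pA xB; rewrite !inE /= => /andP[Ka _] /BS; rewrite /K in Ka; lra.
  have : rho A \is a fin_num by exact: fin_num_measure.
  have : 0 <= rho A by exact: measure_ge0.
  case: (rho A) => // r; rewrite -EFinM !lee_fin => r0 _ h.
  by have -> : r = 0%R by lra.
have := negligible_bigcup strip0; apply: negligibleS => z /= /negP.
rewrite -ltNge => Ka; exists (Num.bound `|a z|%R) => //=; rewrite Ka/=.
by apply: le_trans (ler_norm _) (ltW _); exact: archi_boundP.
Qed.

(** Where [a < y0 - K] the slack is below [y0] and the density is at most [1 / 2], so this set [A]
    satisfies [rho A <= rho A / 2]. *)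
Lemma ae_lower_bound (K : R) :
  {ae mu, forall x, (S x <= a (p x) + K)%R} ->
  (forall A, measurable A -> rho A <= \int[mu]_x (\1_A (p x) * dpsi (S x))%:E) ->
  exists K' : R, {ae rho, forall z, (K' <= a z)%R}.
Proof.
move=> SK ge_rho; have [y0 hy0] := conjugate_deriv_small H Hd.
exists (y0 - K)%R; set A := [set z | (a z < y0 - K)%R].
have mA : measurable A by exact: measurable_lt.
have : rho A <= (1 / 2)%:E * rho A.
  apply: le_trans (ge_rho _ mA) _.
  rewrite -murho// -[X in mu X]setIT -integral_indic; last 2 first.
  - exact: measurableT.
  - exact: measurable_preimage_p.
  rewrite -ge0_integralZl_EFin//; last first.
    by apply/measurable_EFinP; exact: mindic_p.
  apply: ae_ge0_le_integral => //.
  - by move=> x _; rewrite lee_fin mulr_ge0// conjugate_deriv_ge0.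
  - by apply/measurable_EFinP; apply: measurable_funM => //; exact: mindic_p.
  - apply/measurable_EFinP; apply: measurable_funM => //; exact: mindic_p.
  apply: filterS SK => x SxK _; rewrite -EFinM lee_fin !indicE.
  have -> : (x \in p @^-1` A) = (p x \in A) by apply/idP/idP; rewrite !inE.
  have [pA|pA] := boolP (p x \in A); last by rewrite mulr0 mul0r.
  rewrite mulr1 [leLHS]mul1r; apply: le_trans hy0.
  by apply: (conjugate_deriv_nondecreasing H Hd); move: pA; rewrite inE /A /=; lra.
have : rho A \is a fin_num by exact: fin_num_measure.
have : 0 <= rho A by exact: measure_ge0.
move=> rA0 rAf rA2.
have rhoA0 : rho A = 0.
  move: rA0 rAf rA2; case: (rho A) => // r; rewrite -EFinM !lee_fin => r0 _ h.
  by have -> : r = 0%R by lra.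
exists A; split => // z /= /negP; rewrite -ltNge//.
Qed.

End essential_bounds.

(** * The integrated Young inequality *)

Section density.
Context {R : realType} d {T : measurableType d} (g mu : probability T R).
Local Notation RN := ('d (charge_of_finite_measure g) '/d mu).

(** A density that is real and nonnegative everywhere, so that Young's inequality can be applied
    pointwise without an exceptional set. *)
Lemma density_exists : g `<< mu -> exists q : T -> R,
  [/\ measurable_fun setT q, (forall x, 0 <= q x)%R,
      ae_eq mu setT RN (EFin \o q) &
      forall f : T -> R, g.-integrable setT (EFin \o f) ->
        mu.-integrable setT (EFin \o (fun x => f x * q x)%R) /\
        \int[mu]_x (f x * q x)%:E = \int[g]_x (f x)%:E].
Proof.
move=> gmu; pose q0 := Radon_Nikodym_SigmaFinite.f g mu.
have q0E x : (fine (q0 x))%:E = q0 x.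
  by rewrite fineK// Radon_Nikodym_SigmaFinite.f_fin_num.
have mq : measurable_fun setT (fine \o q0).
  apply: measurableT_comp => //.
  exact: measurable_int (Radon_Nikodym_SigmaFinite.f_integrable gmu).
have q0_ge0 x : (0 <= fine (q0 x))%R.
  by rewrite fine_ge0// Radon_Nikodym_SigmaFinite.f_ge0.
exists (fine \o q0); split => //.
  apply: ae_eq_sym; have := ae_eq_Radon_Nikodym_SigmaFinite gmu measurableT.
  by apply: filterS => x h _ /=; rewrite q0E; exact: h.
move=> f fi; have mf : measurable_fun setT f.
  by apply/measurable_EFinP; have [] := integrableP _ _ _ fi.
have mfq : measurable_fun setT (EFin \o (fun x => f x * (fine \o q0) x)%R).
  by apply/measurable_EFinP; exact: measurable_funM.
split.
  apply/integrableP; split => //.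
  under eq_integral => x _.
    rewrite /= normrM (ger0_norm (q0_ge0 x)) EFinM q0E.
    over.
  rewrite (Radon_Nikodym_SigmaFinite.change_of_variables gmu)//; last first.
    by apply/measurable_EFinP; exact: measurableT_comp.
  by have [_] := integrableP _ _ _ fi.
rewrite -(Radon_Nikodym_change_of_variables gmu measurableT fi).
apply: ae_eq_integral => //.
  apply: emeasurable_funM; first exact/measurable_EFinP.
  exact: (measurable_int _ (Radon_Nikodym_integrable _)).
have := ae_eq_Radon_Nikodym_SigmaFinite gmu measurableT.
by apply: filterS => x h _ /=; rewrite EFinM q0E; congr (_ * _); exact: h.
Qed.

End density.

Section integrated_young.
Context {R : realType} (Phi : \bar R -> \bar R).
Hypothesis H : is_entropy Phi.
Hypothesis Hd : forall y : R, derivable (conjugate_real Phi) y 1%R.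
Local Notation psi := (conjugate_real Phi).
Local Notation dpsi := ((conjugate_real Phi)^`()%classic).
Context d {T : measurableType d} (g mu : probability T R).
Local Notation RN := ('d (charge_of_finite_measure g) '/d mu).
Hypothesis gmu : g `<< mu.
Variable S : T -> R.
Hypothesis iS : g.-integrable setT (EFin \o S).
Hypothesis ipS : mu.-integrable setT (EFin \o (psi \o S)).

Let mPhi (q : T -> R) : measurable_fun setT q ->
  measurable_fun setT (fun x => Phi (q x)%:E).
Proof. exact: measurableT_comp (measurable_entropy H). Qed.

Let mPhiRN : measurable_fun setT (Phi \o RN).
Proof.
rewrite (_ : _ \o _ = fun x => Phi (fine (RN x))%:E); last first.
  by apply/funext => x /=; rewrite fineK// Radon_Nikodym_fin_num.
apply: mPhi; apply: measurableT_comp => //.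
Qed.

(** [G] is the pointwise gap in Young's inequality at the density of [g]. Its nonnegativity gives
    the integrated inequality, and its vanishing almost everywhere gives the equality case. *)
Let young_gap : \int[mu]_x Phi (RN x) < +oo -> exists q : T -> R,
  let G x := Phi (q x)%:E + (psi (S x))%:E - (S x * q x)%:E in
  [/\ ae_eq mu setT RN (EFin \o q), measurable_fun setT G, forall x, 0 <= G x &
      \int[mu]_x G x = \int[mu]_x Phi (RN x) + \int[mu]_x (psi (S x))%:E
                       - \int[g]_x (S x)%:E].
Proof.
move=> Phi_oo; have [q [mq q0 RNq qM]] := density_exists gmu.
have [iSq <-] := qM _ iS.
have mPhiq := mPhi mq.
have PhiE : \int[mu]_x Phi (RN x) = \int[mu]_x Phi (q x)%:E.
  by apply: ae_eq_integral => //; apply: filterS RNq => x h _ /=; rewrite h.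
have iPhi : mu.-integrable setT (fun x => Phi (q x)%:E).
  apply/integrableP; split => //.
  under eq_integral do rewrite gee0_abs ?(entropy_ge0 H)//.
  by rewrite -PhiE.
have iPS : mu.-integrable setT (fun x => Phi (q x)%:E + (psi (S x))%:E).
  exact: (@integrableD _ _ _ mu setT measurableT _ _ iPhi ipS).
exists q => G; split => //.
- apply: emeasurable_funB; first exact: measurable_int iPS.
  exact: measurable_int iSq.
- move=> x; have := young H (q x) (S x).
  by rewrite /G suber_ge0// [(S x * _)%R]mulrC.
- rewrite PhiE -(integralD measurableT iPhi ipS).
  exact: (integralB measurableT iPS iSq).
Qed.

Let ipS_fin : \int[mu]_x (psi (S x))%:E \is a fin_num.
Proof. exact: (integrable_fin_num measurableT ipS). Qed.

Let iS_fin : \int[g]_x (S x)%:E \is a fin_num.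
Proof. exact: (integrable_fin_num measurableT iS). Qed.

Lemma integrated_young : \int[g]_x (S x)%:E <=
  \int[mu]_x Phi (RN x) + \int[mu]_x (psi (S x))%:E.
Proof.
have [Phi_oo|] := ltP (\int[mu]_x Phi (RN x)) +oo; last first.
  rewrite leye_eq => /eqP ->; move: ipS_fin.
  by case: (\int[mu]_x (psi (S x))%:E) => // r _; rewrite addye// leey.
have [q [_ _ G0 GE]] := young_gap Phi_oo.
by rewrite -sube_ge0 ?iS_fin// -GE; exact: integral_ge0.
Qed.

Lemma integrated_young_eq :
  \int[mu]_x Phi (RN x) + \int[mu]_x (psi (S x))%:E <= \int[g]_x (S x)%:E ->
  ae_eq mu setT RN (EFin \o (dpsi \o S)).
Proof.
move=> hle; have Phi_oo : \int[mu]_x Phi (RN x) < +oo.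
  move: hle ipS_fin iS_fin; case: (\int[mu]_x (psi (S x))%:E) => // r.
  case: (\int[g]_x (S x)%:E) => // s.
  by case: (\int[mu]_x Phi (RN x)) => // r' *; rewrite ltry.
have [q [RNq mG G0 GE]] := young_gap Phi_oo.
have : \int[mu]_x `|Phi (q x)%:E + (psi (S x))%:E - (S x * q x)%:E| = 0.
  under eq_integral do rewrite gee0_abs//.
  by apply/eqP; rewrite eq_le integral_ge0// andbT GE sube_le0.
move=> /(ae_eq_integral_abs _ measurableT mG) G_eq0.
apply: filterS2 RNq G_eq0 => x -> // h _ /=; congr EFin.
apply: (fenchel_eq_unique H Hd); have := h I; have := entropy_ge0 H (q x)%:E.
case: (Phi _) => [r| |] // _ /(congr1 fine)/= rE.
rewrite lee_fin mulrC; lra.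
Qed.

(** Fenchel's equality replaces [Phi q] by [S * q - psi S], whose two terms are known to be
    integrable; finiteness of the entropy is thus a consequence. *)
Lemma integrated_fenchel : ae_eq mu setT RN (EFin \o (dpsi \o S)) ->
  \int[mu]_x Phi (RN x) + \int[mu]_x (psi (S x))%:E = \int[g]_x (S x)%:E.
Proof.
move=> RNS; have [q [mq q0 RNq qM]] := density_exists gmu.
have [iSq <-] := qM _ iS.
have -> : \int[mu]_x Phi (RN x) = \int[mu]_x ((S x * q x)%:E - (psi (S x))%:E).
  apply: ae_eq_integral => //.
    by apply: emeasurable_funB; [exact: measurable_int iSq|exact: measurable_int ipS].
  apply: filterS2 RNS RNq => x -> // h _ /=.
  have := h I; rewrite /= => -[<-].
  by rewrite (fenchel_eq H Hd) mulrC EFinB.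
by rewrite (integralB_EFin measurableT iSq ipS) subeK.
Qed.

End integrated_young.

(** * Real representatives of the potentials *)

Section representatives.
Context {R : realType} (Phi : \bar R -> \bar R) (eps : R).
Hypothesis H : is_entropy Phi.
Hypothesis Hd : forall y : R, derivable (conjugate_real Phi) y 1%R.
Hypothesis eps0 : (0 < eps)%R.
Local Notation psi := (conjugate_real Phi).

(* Rescaled by [eps] as in the arguments of the conjugate; the values [-oo] are
   confined to a null set. *)
Definition represents d (T : measurableType d) (rho : probability T R)
    (u : T -> \bar R) (a : T -> R) : Prop :=
  measurable_fun setT a /\ {ae rho, forall x, u x = (eps * a x)%:E}.

Context d {T : measurableType d} (rho : probability T R).

Lemma representsE (a : T -> R) : measurable_fun setT a ->
  represents rho (fun x => (eps * a x)%:E) a.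
Proof. by move=> ma; split => //; exact: aeW. Qed.

Let scaleK (r : R) : (eps^-1)%:E * (eps * r)%:E = r%:E.
Proof. by rewrite -EFinM mulKf// gt_eqF. Qed.

Lemma represents_ae_finite (u : T -> \bar R) : measurable_fun setT u ->
  {ae rho, forall x, u x \is a fin_num} ->
  represents rho u (fun x => eps^-1 * fine (u x))%R.
Proof.
move=> mu ufin; split.
  by apply: measurable_funM => //; exact: measurableT_comp.
by apply: filterS ufin => x ux; rewrite mulVKf ?gt_eqF// fineK.
Qed.

Lemma integrable_conjugate_Lphi (u : T -> \bar R) : Lphi Phi eps rho u ->
  rho.-integrable setT (fun x => conjugate Phi ((eps^-1)%:E * u x)).
Proof.
move=> [mu uy /andP[p0 poo]].
have mc : measurable_fun setT (fun x => conjugate Phi ((eps^-1)%:E * u x)).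
  apply: measurableT_comp (measurable_conjugate H) _.
  exact: measurable_funeM.
apply: fin_num_integrable => //.
by rewrite fin_numElt poo andbT (lt_trans _ p0)// ltNyr.
Qed.

(** The minorant of the conjugate gives [u <= eps * conjugate Phi (u / eps)], an integrable upper
    bound; an integral above [-oo] then controls the negative part. *)
Let Lphi_integrable (u : T -> \bar R) : Lphi Phi eps rho u ->
  -oo < \int[rho]_x u x -> rho.-integrable setT u.
Proof.
move=> Lu u_oo; have ic := integrable_conjugate_Lphi Lu.
have [mu _ _] := Lu.
apply: (integrable_le mu (integrableZl measurableT eps ic)) u_oo => x.
apply: (@le_trans _ _ (eps%:E * ((eps^-1)%:E * u x))).
  by rewrite muleA -EFinM mulfV ?gt_eqF// mul1e.
by apply: lee_wpmul2l; [rewrite lee_fin ltW|exact: conjugate_lb].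
Qed.

Lemma Lphi_represented (u : T -> \bar R) : Lphi Phi eps rho u ->
  -oo < \int[rho]_x u x -> exists a : T -> R, represents rho u a.
Proof.
move=> Lu u_oo; have [mu _ _] := Lu.
eexists; apply: (represents_ae_finite mu).
have := integrable_ae measurableT (Lphi_integrable Lu u_oo).
by apply: filterS => x; exact.
Qed.

Lemma Lphi_represents (u : T -> \bar R) (a : T -> R) : Lphi Phi eps rho u ->
  -oo < \int[rho]_x u x -> represents rho u a ->
  [/\ rho.-integrable setT (EFin \o a),
      rho.-integrable setT (EFin \o (psi \o a)) &
      0 < \int[rho]_x (psi (a x))%:E].
Proof.
move=> Lu u_oo [ma uE]; have ic := integrable_conjugate_Lphi Lu.
have iu := Lphi_integrable Lu u_oo.
have [mu uy /andP[p0 poo]] := Lu.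
have mpa : measurable_fun setT (fun x => (psi (a x))%:E).
  apply/measurable_EFinP; exact: measurableT_comp (measurable_conjugate_real H) _.
have psiE : {ae rho, forall x,
    conjugate Phi ((eps^-1)%:E * u x) = (psi (a x))%:E}.
  by apply: filterS uE => x ->; rewrite scaleK (conjugate_EFin H).
split.
- have := integrableZl measurableT eps^-1 iu.
  apply: ae_eq_integrable; first exact/measurable_EFinP.
  by apply: filterS uE => x ->; rewrite scaleK.
- exact: ae_eq_integrable ic.
- rewrite (ae_eq_integral (fun x => conjugate Phi ((eps^-1)%:E * u x)))//.
    exact: measurable_int ic.
  by apply: filterS psiE => x ->.
Qed.

Lemma Lphi_scale (a : T -> R) : measurable_fun setT a ->
  rho.-integrable setT (EFin \o (psi \o a)) ->
  0 < \int[rho]_x (psi (a x))%:E -> Lphi Phi eps rho (fun x => (eps * a x)%:E).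
Proof.
move=> ma ipa p0; split.
- by apply/measurable_EFinP; apply: measurable_funM.
- by move=> x; rewrite ltry.
under eq_integral do rewrite scaleK (conjugate_EFin H).
by rewrite p0/= ltey_eq (integrable_fin_num measurableT ipa).
Qed.

End representatives.

(** * The dual functional on real representatives *)

Section dual_of_representatives.
Context {R : realType} (Phi : \bar R -> \bar R) (eps : R).
Hypothesis H : is_entropy Phi.
Hypothesis Hd : forall y : R, derivable (conjugate_real Phi) y 1%R.
Hypothesis eps0 : (0 < eps)%R.
Local Notation psi := (conjugate_real Phi).
Local Notation dpsi := ((conjugate_real Phi)^`()%classic).
Context {d1 d2} {X : measurableType d1} {Y : measurableType d2}.
Variables (c : X * Y -> R) (M : R).
Hypothesis mc : measurable_fun setT c.
Hypothesis cM : forall z, (`|c z| <= M)%R.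
Variables (rho1 : probability X R) (rho2 : probability Y R).
Local Notation mu := (rho1 \x rho2 : probability (X * Y)%type R).

Definition scaled_slack (a : X -> R) (b : Y -> R) (z : X * Y) : R :=
  (a z.1 + b z.2 - eps^-1 * c z)%R.

Lemma product_fst (A : set X) : measurable A -> mu (fst @^-1` A) = rho1 A.
Proof.
move=> mA; rewrite -setXT [LHS]product_measure1E//.
by rewrite [X in _ * X]probability_setT mule1.
Qed.

Lemma product_snd (B : set Y) : measurable B -> mu (snd @^-1` B) = rho2 B.
Proof.
move=> mB; rewrite -setTX [LHS]product_measure1E//.
by rewrite [X in X * _]probability_setT mul1e.
Qed.

Lemma measurable_scaled_slack a b : measurable_fun setT a ->
  measurable_fun setT b -> measurable_fun setT (scaled_slack a b).
Proof.
move=> ma mb; apply: measurable_funB; last exact: measurable_funM.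
by apply: measurable_funD; exact: measurableT_comp.
Qed.

Lemma integrable_cost (g : probability (X * Y)%type R) :
  g.-integrable setT (EFin \o c).
Proof. exact: bounded_integrable mc cM. Qed.

(** Only the marginals of [g] enter, so the statement serves the product measure and every competing
    coupling alike. *)
Lemma integrable_scaled_slack (g : probability (X * Y)%type R) a b :
  (forall A, measurable A -> g (fst @^-1` A) = rho1 A) ->
  (forall B, measurable B -> g (snd @^-1` B) = rho2 B) ->
  rho1.-integrable setT (EFin \o a) -> rho2.-integrable setT (EFin \o b) ->
  g.-integrable setT (EFin \o scaled_slack a b).
Proof.
move=> g1 g2 ia ib; apply: integrable_subr; last first.
  exact: (integrable_mulr _ (integrable_cost g)).
apply: integrable_addr.
- exact: (integrable_marginal measurable_fst g1 ia).
- exact: (integrable_marginal measurable_snd g2 ib).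
Qed.

Lemma integral_scaled_slack (g : probability (X * Y)%type R) a b :
  (forall A, measurable A -> g (fst @^-1` A) = rho1 A) ->
  (forall B, measurable B -> g (snd @^-1` B) = rho2 B) ->
  rho1.-integrable setT (EFin \o a) -> rho2.-integrable setT (EFin \o b) ->
  \int[g]_z (scaled_slack a b z)%:E =
  \int[rho1]_x (a x)%:E + \int[rho2]_y (b y)%:E
  - (eps^-1)%:E * \int[g]_z (c z)%:E.
Proof.
move=> g1 g2 ia ib.
have iag := integrable_marginal measurable_fst g1 ia.
have ibg := integrable_marginal measurable_snd g2 ib.
have icg := integrable_mulr eps^-1 (integrable_cost g).
rewrite -(integral_marginal measurable_fst g1 ia).
rewrite -(integral_marginal measurable_snd g2 ib).
rewrite -(integralZl measurableT (integrable_cost g)).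
rewrite -(integralD measurableT iag ibg).
rewrite -(integralB measurableT (integrableD measurableT iag ibg) icg).
by apply: eq_integral => z _.
Qed.

Lemma slack_represents u v a b :
  represents eps rho1 u a -> represents eps rho2 v b ->
  {ae mu, forall z, slack eps c u v z = (scaled_slack a b z)%:E}.
Proof.
move=> [_ ua] [_ vb].
have {}ua := ae_marginal measurable_fst product_fst ua.
have {}vb := ae_marginal measurable_snd product_snd vb.
apply: filterS2 ua vb => z uz vz; rewrite /slack uz vz /=.
rewrite -!EFinD -EFinM; congr EFin; rewrite /scaled_slack mulrBr mulrDr !mulrA.
by rewrite mulVf ?gt_eqF// !mul1r.
Qed.

Lemma measurable_slack u v : measurable_fun setT u -> measurable_fun setT v ->
  measurable_fun setT (slack eps c u v).
Proof.
move=> mfu mfv; apply: measurable_funeM; apply: emeasurable_funB.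
  by apply: emeasurable_funD; exact: measurableT_comp.
exact/measurable_EFinP.
Qed.

Lemma integral_conjugate_slack u v a b : measurable_fun setT u ->
  measurable_fun setT v -> represents eps rho1 u a -> represents eps rho2 v b ->
  \int[mu]_z conjugate Phi (slack eps c u v z) =
  \int[mu]_z (psi (scaled_slack a b z))%:E.
Proof.
move=> mfu mfv ua vb; apply: ae_eq_integral => //.
- by apply: measurableT_comp (measurable_conjugate H) _; exact: measurable_slack.
- apply/measurable_EFinP; apply: measurableT_comp (measurable_conjugate_real H) _.
  by apply: measurable_scaled_slack; [case: ua|case: vb].
- by apply: filterS (slack_represents ua vb) => z -> _; rewrite (conjugate_EFin H).
Qed.

Lemma integral_represents d (T : measurableType d) (rho : probability T R) u a :
  measurable_fun setT u -> represents eps rho u a ->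
  rho.-integrable setT (EFin \o a) ->
  \int[rho]_x u x = eps%:E * \int[rho]_x (a x)%:E.
Proof.
move=> mfu [ma ua] ia; rewrite -(integralZl measurableT ia).
apply: ae_eq_integral => //.
- by apply/measurable_EFinP; exact: measurable_funM.
- by apply: filterS ua => x ->.
Qed.

Lemma dual_represents u v a b : measurable_fun setT u ->
  measurable_fun setT v -> represents eps rho1 u a -> represents eps rho2 v b ->
  rho1.-integrable setT (EFin \o a) -> rho2.-integrable setT (EFin \o b) ->
  dual Phi eps c rho1 rho2 u v =
  eps%:E * (\int[rho1]_x (a x)%:E + \int[rho2]_y (b y)%:E
            - \int[mu]_z (psi (scaled_slack a b z))%:E).
Proof.
move=> mfu mfv ua vb ia ib; rewrite /dual.
rewrite (integral_represents mfu ua ia) (integral_represents mfv vb ib).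
rewrite (integral_conjugate_slack mfu mfv ua vb).
have := integrable_fin_num measurableT ib.
have := integrable_fin_num measurableT ia.
case: (\int[rho1]_x _) => // r1 _; case: (\int[rho2]_x _) => // r2 _.
by rewrite [RHS]muleBr ?fin_num_adde_defr// [in RHS]muleDr//.
Qed.

Let dual_gtNy_integrals u v : -oo < dual Phi eps c rho1 rho2 u v ->
  -oo < \int[rho1]_x u x /\ -oo < \int[rho2]_x v x.
Proof.
rewrite /dual => dual_oo; split.
  by move: dual_oo; case: (\int[rho1]_x _) => // r; rewrite !ltNyr.
move: dual_oo; case: (\int[rho2]_x _) => //.
  by move=> r _; rewrite ltNyr.
by rewrite addeNy addNye.
Qed.

Lemma dual_gtNy_represented u v : Lphi Phi eps rho1 u -> Lphi Phi eps rho2 v ->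
  -oo < dual Phi eps c rho1 rho2 u v ->
  exists a b, represents eps rho1 u a /\ represents eps rho2 v b.
Proof.
move=> Lu Lv /dual_gtNy_integrals[u_oo v_oo].
have [a ua] := Lphi_represented H eps0 Lu u_oo.
by have [b vb] := Lphi_represented H eps0 Lv v_oo; exists a, b.
Qed.

(** The slack itself is an integrable minorant of [psi] of the slack, so the integral of the latter
    can only fail by being [+oo], which would send the dual value to [-oo]. *)
Lemma dual_gtNy_represents u v a b : Lphi Phi eps rho1 u ->
  Lphi Phi eps rho2 v -> -oo < dual Phi eps c rho1 rho2 u v ->
  represents eps rho1 u a -> represents eps rho2 v b ->
  [/\ rho1.-integrable setT (EFin \o a),
      rho1.-integrable setT (EFin \o (psi \o a)) &
      0 < \int[rho1]_x (psi (a x))%:E] /\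
  [/\ rho2.-integrable setT (EFin \o b),
      rho2.-integrable setT (EFin \o (psi \o b)) &
      0 < \int[rho2]_x (psi (b x))%:E] /\
  mu.-integrable setT (EFin \o (psi \o scaled_slack a b)).
Proof.
move=> Lu Lv dual_oo ua vb; have [u_oo v_oo] := dual_gtNy_integrals dual_oo.
have [ia ipa a0] := Lphi_represents H eps0 Lu u_oo ua.
have [ib ipb b0] := Lphi_represents H eps0 Lv v_oo vb.
have [mfu _ _] := Lu; have [mfv _ _] := Lv.
do 2 split => //.
have iS := integrable_scaled_slack product_fst product_snd ia ib.
apply: (integrable_ge _ iS) => //.
- apply/measurable_EFinP; apply: measurableT_comp (measurable_conjugate_real H) _.
  by apply: measurable_scaled_slack; [case: ua|case: vb].
- by move=> z; rewrite lee_fin conjugate_real_ge.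
move: dual_oo; rewrite (dual_represents mfu mfv ua vb ia ib).
case: (\int[rho1 \x rho2]_x _) => //= [r|]; first by rewrite ltry.
by rewrite addeNy gt0_muleNy ?lte_fin.
Qed.

End dual_of_representatives.

(** * Weak duality *)

Section weak_duality.
Context {R : realType} (Phi : \bar R -> \bar R) (eps : R).
Hypothesis H : is_entropy Phi.
Hypothesis Hd : forall y : R, derivable (conjugate_real Phi) y 1%R.
Hypothesis eps0 : (0 < eps)%R.
Local Notation psi := (conjugate_real Phi).
Local Notation dpsi := ((conjugate_real Phi)^`()%classic).
Context {d1 d2} {X : measurableType d1} {Y : measurableType d2}.
Variables (c : X * Y -> R) (M : R).
Hypothesis mc : measurable_fun setT c.
Hypothesis cM : forall z, (`|c z| <= M)%R.
Variables (rho1 : probability X R) (rho2 : probability Y R).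
Local Notation mu := (rho1 \x rho2 : probability (X * Y)%type R).
Local Notation RN g := ('d (charge_of_finite_measure g) '/d mu).

Section fixed_coupling.
Variables (g : probability (X * Y)%type R).
Hypothesis gC : couplings rho1 rho2 g.
Variables (a : X -> R) (b : Y -> R).
Hypothesis ia : rho1.-integrable setT (EFin \o a).
Hypothesis ib : rho2.-integrable setT (EFin \o b).
Local Notation S := (scaled_slack eps c a b).
Hypothesis ipS : mu.-integrable setT (EFin \o (psi \o S)).
Local Notation value := (eps%:E * (\int[rho1]_x (a x)%:E + \int[rho2]_y (b y)%:E
                         - \int[mu]_z (psi (S z))%:E)).

Let g1 A : measurable A -> g (fst @^-1` A) = rho1 A.
Proof. by move=> mA; rewrite -setXT; exact: gC.1. Qed.

Let g2 B : measurable B -> g (snd @^-1` B) = rho2 B.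
Proof. by move=> mB; rewrite -setTX; exact: gC.2. Qed.

Let iS : g.-integrable setT (EFin \o S).
Proof. exact: (integrable_scaled_slack eps mc cM g1 g2 ia ib). Qed.

Let SE := integral_scaled_slack eps mc cM g1 g2 ia ib.

Let C_fin : \int[g]_z (c z)%:E \is a fin_num.
Proof. exact: (integrable_fin_num measurableT (integrable_cost mc cM g)). Qed.

Let A_fin : \int[rho1]_x (a x)%:E \is a fin_num.
Proof. exact: (integrable_fin_num measurableT ia). Qed.

Let B_fin : \int[rho2]_x (b x)%:E \is a fin_num.
Proof. exact: (integrable_fin_num measurableT ib). Qed.

Let P_fin : \int[mu]_z (psi (S z))%:E \is a fin_num.
Proof. exact: (integrable_fin_num measurableT ipS). Qed.

Lemma primal_dominated : g `<< mu ->
  primal Phi eps c rho1 rho2 g =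
  \int[g]_z (c z)%:E + eps%:E * \int[mu]_z Phi (RN g z).
Proof. by move=> gmu; rewrite /primal /divergence; case: ifPn => // /asboolP. Qed.

Lemma primal_not_dominated : ~ g `<< mu -> primal Phi eps c rho1 rho2 g = +oo.
Proof.
move=> gmu; rewrite /primal /divergence; case: ifPn => [/asboolP//|_].
by rewrite gt0_muley ?lte_fin//; case: (\int[g]_z _) C_fin.
Qed.

Let Phi_ge0 : 0 <= \int[mu]_z Phi (RN g z).
Proof. by apply: integral_ge0 => z _; exact: entropy_ge0. Qed.

(** The integrated Young inequality multiplied by [eps]: through the marginals, the integral of the
    slack against [g] is the linear part of the dual minus [eps^-1] times the transport cost. *)
Lemma value_le_primal : value <= primal Phi eps c rho1 rho2 g.
Proof.
have [gmu|gmu] := pselect (g `<< mu); last first.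
  by rewrite primal_not_dominated// leey.
rewrite primal_dominated//; have := integrated_young H gmu iS ipS.
rewrite SE; move: A_fin B_fin P_fin C_fin Phi_ge0.
case: (\int[rho1]_x _) => // A _; case: (\int[rho2]_y _) => // B _.
case: (\int[_]_z (psi _)%:E) => // P _; case: (\int[g]_z _) => // C _.
case: (\int[_]_z _) => // [D D0|_ _]; last first.
  by rewrite gt0_muley ?lte_fin// addey// leey.
rewrite -!EFinM -!EFinD !lee_fin => h; rewrite -(ler_pM2l eps0) in h.
move: h; rewrite !mulrDr mulrN mulrA mulfV ?gt_eqF// mul1r; lra.
Qed.

Lemma primal_eq_value : g `<< mu -> ae_eq mu setT (RN g) (EFin \o (dpsi \o S)) ->
  primal Phi eps c rho1 rho2 g = value.
Proof.
move=> gmu RNS; rewrite primal_dominated//.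
have := integrated_fenchel H Hd gmu iS ipS RNS.
rewrite SE; move: A_fin B_fin P_fin C_fin Phi_ge0.
case: (\int[rho1]_x _) => // A _; case: (\int[rho2]_y _) => // B _.
case: (\int[_]_z (psi _)%:E) => // P _; case: (\int[g]_z _) => // C _.
case: (\int[_]_z _) => // D D0.
rewrite -!EFinM -!EFinD => -[h]; congr EFin.
have -> : D = (A + B - eps^-1 * C - P)%R by lra.
by rewrite !mulrDr !mulrN mulrA mulfV ?gt_eqF// mul1r; lra.
Qed.

Lemma primal_le_value : primal Phi eps c rho1 rho2 g <= value ->
  g `<< mu /\ ae_eq mu setT (RN g) (EFin \o (dpsi \o S)).
Proof.
move=> hle; have [gmu|gmu] := pselect (g `<< mu); last first.
  move: hle; rewrite primal_not_dominated// leye_eq => /eqP.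
  move: A_fin B_fin P_fin.
  case: (\int[rho1]_x _) => // A _; case: (\int[rho2]_y _) => // B _.
  by case: (\int[_]_z (psi _)%:E).
split => //; apply: (integrated_young_eq H Hd gmu iS ipS).
move: hle; rewrite primal_dominated// SE; move: A_fin B_fin P_fin C_fin Phi_ge0.
case: (\int[rho1]_x _) => // A _; case: (\int[rho2]_y _) => // B _.
case: (\int[_]_z (psi _)%:E) => // P _; case: (\int[g]_z _) => // C _.
case: (\int[_]_z _) => // [D D0|_]; last first.
  by rewrite gt0_muley ?lte_fin// addey// leye_eq.
rewrite -!EFinM -!EFinD !lee_fin => h; rewrite -(ler_pM2l eps0).
by rewrite !mulrDr !mulrN mulrA mulfV ?gt_eqF// mul1r; move: h; rewrite !mulrDr; lra.
Qed.

End fixed_coupling.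

Lemma dual_le_primal u v g : Lphi Phi eps rho1 u -> Lphi Phi eps rho2 v ->
  couplings rho1 rho2 g ->
  dual Phi eps c rho1 rho2 u v <= primal Phi eps c rho1 rho2 g.
Proof.
move=> Lu Lv gC; have [|dual_oo] := leP (dual Phi eps c rho1 rho2 u v) -oo.
  by rewrite leeNy_eq => /eqP ->; rewrite leNye.
have [a [b [ua vb]]] := dual_gtNy_represented H eps0 Lu Lv dual_oo.
have [[ia _ _] [[ib _ _] ipS]] :=
  dual_gtNy_represents H eps0 mc cM Lu Lv dual_oo ua vb.
have [mfu _ _] := Lu; have [mfv _ _] := Lv.
rewrite (dual_represents H eps0 mc mfu mfv ua vb ia ib).
exact: value_le_primal.
Qed.

Lemma dual_sup_le_OT : dual_sup Phi eps c rho1 rho2 <= OT Phi eps c rho1 rho2.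
Proof.
apply: ge_ereal_sup => _ [[u v] [/= Lu Lv] <-].
by apply: le_ereal_inf_tmp => _ [g gC <-]; exact: dual_le_primal.
Qed.

(** The competitors are constant potentials of scaled value [1], for which [psi 1 >= 1 > 0]. Zero
    potentials are not admissible, because [psi 0 = 0] violates the strict positivity in [Lphi]. *)
Lemma dual_sup_gtNy : -oo < dual_sup Phi eps c rho1 rho2.
Proof.
have p1 : (1 <= psi 1)%R by exact: conjugate_real_ge.
have L1 d (T : measurableType d) (rho : probability T R) :
    Lphi Phi eps rho (fun=> (eps * 1)%:E).
  apply: (Lphi_scale H eps0 (a := fun=> 1%R)) => //.
    exact: finite_measure_integrable_cst.
  rewrite integral_cst// [X in _ * X]probability_setT mule1 lte_fin.
  exact: lt_le_trans p1.
apply: lt_le_trans; last first.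
  apply: ereal_sup_ubound.
  by exists (fun=> (eps * 1)%:E, fun=> (eps * 1)%:E) => //=; split; exact: L1.
have i1 d (T : measurableType d) (rho : probability T R) :
    rho.-integrable setT (EFin \o fun=> 1%R : R).
  exact: finite_measure_integrable_cst.
have mS : measurable_fun setT (scaled_slack eps c (fun=> 1%R) (fun=> 1%R)).
  exact: measurable_scaled_slack.
rewrite (dual_represents H eps0 mc _ _ (representsE _ _ _) (representsE _ _ _))//.
have : mu.-integrable setT
    (EFin \o (psi \o scaled_slack eps c (fun=> 1%R) (fun=> 1%R))).
  have b1 z : (`|scaled_slack eps c (fun=> 1%R) (fun=> 1%R) z| <= 2 + eps^-1 * M)%R.
    rewrite /scaled_slack; apply: le_trans (ler_normB _ _) _.
    have e0 : (0 <= eps^-1)%R by rewrite invr_ge0 ltW.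
    apply: lerD; first by rewrite ger0_norm.
    by rewrite normrM (ger0_norm e0) ler_wpM2l.
  apply: (@integrable_between _ _ _ mu _ (fun=> psi (- (2 + eps^-1 * M)))%R
    (fun=> psi (2 + eps^-1 * M))%R).
  - exact: measurableT_comp (measurable_conjugate_real H) _.
  - move=> z; have := b1 z; rewrite ler_norml => /andP[h1 h2].
    by rewrite !(conjugate_real_nondecreasing H).
  - exact: finite_measure_integrable_cst.
  - exact: finite_measure_integrable_cst.
move=> /(integrable_fin_num measurableT).
move: (integrable_fin_num measurableT (i1 _ _ rho1)).
move: (integrable_fin_num measurableT (i1 _ _ rho2)).
case: (\int[rho2]_y _) => // B _; case: (\int[rho1]_x _) => // A _.
by case: (\int[_]_z (psi _)%:E) => // P _; rewrite ltNyr.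
Qed.

End weak_duality.

(** * The marginal equations *)

Section first_order_conditions.
Context {R : realType} (Phi : \bar R -> \bar R) (eps : R).
Hypothesis H : is_entropy Phi.
Hypothesis Hd : forall y : R, derivable (conjugate_real Phi) y 1%R.
Hypothesis eps0 : (0 < eps)%R.
Local Notation psi := (conjugate_real Phi).
Local Notation dpsi := ((conjugate_real Phi)^`()%classic).
Context {d1 d2} {X : measurableType d1} {Y : measurableType d2}.
Variables (c : X * Y -> R) (M : R).
Hypothesis mc : measurable_fun setT c.
Hypothesis cM : forall z, (`|c z| <= M)%R.
Variables (rho1 : probability X R) (rho2 : probability Y R).
Local Notation mu := (rho1 \x rho2 : probability (X * Y)%type R).
Local Notation slk := (scaled_slack eps c).

(** The restriction to sets on which [a] is bounded above reflects what decreasing perturbations of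
    an arbitrary representative can give. *)
Definition first_marginal_le (a : X -> R) (b : Y -> R) : Prop :=
  forall (A : set X) (N : R), measurable A -> (forall x, A x -> a x <= N)%R ->
  \int[mu]_z (\1_A z.1 * dpsi (slk a b z))%:E <= rho1 A.

Definition second_marginal_le (a : X -> R) (b : Y -> R) : Prop :=
  forall (B : set Y) (N : R), measurable B -> (forall y, B y -> b y <= N)%R ->
  \int[mu]_z (\1_B z.2 * dpsi (slk a b z))%:E <= rho2 B.

Definition marginal_equations (a : X -> R) (b : Y -> R) : Prop :=
  (forall A, measurable A ->
     \int[mu]_z (\1_A z.1 * dpsi (slk a b z))%:E = rho1 A) /\
  (forall B, measurable B ->
     \int[mu]_z (\1_B z.2 * dpsi (slk a b z))%:E = rho2 B).

Lemma probability_ge_gt0 d (T : measurableType d) (rho : probability T R)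
    (b : T -> R) : measurable_fun setT b ->
  exists n : nat, measurable [set x | (- n%:R <= b x)%R] /\
    0 < rho [set x | (- n%:R <= b x)%R].
Proof.
move=> mb; pose B n := [set x | (- n%:R <= b x)%R].
have mB n : measurable (B n).
  rewrite (_ : B n = b @^-1` `[(- n%:R)%R, +oo[).
    by rewrite -[X in measurable X]setTI; exact: mb.
  by apply/seteqP; split=> z /=; rewrite in_itv/= andbT.
apply: contrapT => /forallNP noB.
have B0 n : rho.-negligible (B n).
  apply/negligibleP => //; apply/eqP; rewrite eq_le measure_ge0 andbT leNgt.
  by apply/negP => Bn; apply: (noB n); split; [exact: mB|exact: Bn].
have : rho.-negligible setT.
  have := negligible_bigcup B0; apply: negligibleS => x _.
  exists (Num.bound `|b x|%R) => //=; rewrite /B /= lerNl.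
  apply: le_trans (ler_norm _) _; rewrite normrN; apply/ltW.
  exact: archi_boundP.
move=> /negligibleP => /(_ measurableT); rewrite [LHS]probability_setT => /eqP.
by rewrite onee_eq0.
Qed.

Let cost_ub z : (eps^-1 * c z <= eps^-1 * M)%R.
Proof.
apply: ler_wpM2l; first by rewrite invr_ge0 ltW.
exact: le_trans (ler_norm _) (cM z).
Qed.

Let cost_lb z : (- (eps^-1 * c z) <= eps^-1 * M)%R.
Proof.
rewrite -mulrN; apply: ler_wpM2l; first by rewrite invr_ge0 ltW.
by apply: le_trans (ler_norm _) _; rewrite normrN.
Qed.

(** On the cylinder over [B] the slack is at least [a - n - M / eps], and the product structure
    gives its intersection with the cylinder over [A] the mass [rho1 A * rho2 B]. *)
Lemma first_ae_upper_bound a b : measurable_fun setT a -> measurable_fun setT b ->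
  first_marginal_le a b -> exists K : R, {ae rho1, forall x, (a x <= K)%R}.
Proof.
move=> ma mb le_rho; have [n [mB B0]] := probability_ge_gt0 rho2 mb.
set B := [set y | _] in mB B0.
have Bfin : rho2 B \is a fin_num by exact: fin_num_measure.
apply: (@ae_upper_bound _ _ H Hd _ _ _ _ mu rho1 fst measurable_fst a
  (slk a b) ma (measurable_scaled_slack eps mc ma mb) (snd @^-1` B)
  (- n%:R - eps^-1 * M)%R (fine (rho2 B))) => //.
- by rewrite -setTX; exact: measurableX.
- by rewrite fine_gt0// B0/= ltey_eq Bfin.
- move=> A mA; rewrite fineK// muleC.
  by rewrite -[leLHS](product_measure1E rho1 rho2 mA mB).
- move=> z /=; rewrite /B /scaled_slack/= => nb.
  have := cost_ub z; lra.
Qed.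

Lemma second_ae_upper_bound a b : measurable_fun setT a -> measurable_fun setT b ->
  second_marginal_le a b -> exists K : R, {ae rho2, forall y, (b y <= K)%R}.
Proof.
move=> ma mb le_rho; have [n [mA A0]] := probability_ge_gt0 rho1 ma.
set A := [set y | _] in mA A0.
have Afin : rho1 A \is a fin_num by exact: fin_num_measure.
apply: (@ae_upper_bound _ _ H Hd _ _ _ _ mu rho2 snd measurable_snd b
  (slk a b) mb (measurable_scaled_slack eps mc ma mb) (fst @^-1` A)
  (- n%:R - eps^-1 * M)%R (fine (rho1 A))) => //.
- by rewrite -setXT; exact: measurableX.
- by rewrite fine_gt0// A0/= ltey_eq Afin.
- move=> B mB; rewrite fineK// setIC.
  by rewrite -[leLHS](product_measure1E rho1 rho2 mA mB).
- move=> z /=; rewrite /A /scaled_slack/= => na.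
  have := cost_ub z; lra.
Qed.

Lemma marginal_equations_bounds a b : measurable_fun setT a ->
  measurable_fun setT b -> marginal_equations a b ->
  exists K : R, {ae rho1, forall x, (`|a x| <= K)%R} /\
                {ae rho2, forall y, (`|b y| <= K)%R}.
Proof.
move=> ma mb [eq1 eq2]; have mS := measurable_scaled_slack eps mc ma mb.
have [Ka aKa] : exists K : R, {ae rho1, forall x, (a x <= K)%R}.
  by apply: (first_ae_upper_bound ma mb) => A N mA _; rewrite eq1.
have [Kb bKb] : exists K : R, {ae rho2, forall x, (b x <= K)%R}.
  by apply: (second_ae_upper_bound ma mb) => A N mA _; rewrite eq2.
(* Lower bounds come after upper ones: [b <= Kb] gives the slack bound [a + (Kb + M / eps)] from
   which [a] is bounded below, and symmetrically for [b]. *)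
have [La aLa] : exists L : R, {ae rho1, forall x, (L <= a x)%R}.
  apply: (@ae_lower_bound _ _ H Hd _ _ _ _ mu rho1 fst measurable_fst
    (product_fst rho1 rho2) a (slk a b) ma mS (Kb + eps^-1 * M)%R).
    apply: filterS (ae_marginal measurable_snd (product_snd rho1 rho2) bKb).
    by move=> z h; rewrite /scaled_slack; have := cost_lb z; lra.
  by move=> A mA; rewrite eq1.
have [Lb bLb] : exists L : R, {ae rho2, forall x, (L <= b x)%R}.
  apply: (@ae_lower_bound _ _ H Hd _ _ _ _ mu rho2 snd measurable_snd
    (product_snd rho1 rho2) b (slk a b) mb mS (Ka + eps^-1 * M)%R).
    apply: filterS (ae_marginal measurable_fst (product_fst rho1 rho2) aKa).
    by move=> z h; rewrite /scaled_slack; have := cost_lb z; lra.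
  by move=> A mA; rewrite eq2.
have nle (r : R) : (r <= `|r|)%R by exact: ler_norm.
have nge (r : R) : (- r <= `|r|)%R by rewrite -normrN.
exists (`|Ka| + `|Kb| + `|La| + `|Lb|)%R.
have n0 := @normr_ge0 R R.
split.
- apply: filterS2 aKa aLa => x h1 h2; rewrite ler_norml.
  have := nle Ka; have := nge La; have := n0 Kb; have := n0 Lb; have := n0 La.
  by have := n0 Ka; move=> *; apply/andP; split; lra.
- apply: filterS2 bKb bLb => x h1 h2; rewrite ler_norml.
  have := nle Kb; have := nge Lb; have := n0 Ka; have := n0 La; have := n0 Lb.
  by have := n0 Kb; move=> *; apply/andP; split; lra.
Qed.

Lemma marginal_equations_ae a b a' b' : measurable_fun setT a ->
  measurable_fun setT b -> measurable_fun setT a' -> measurable_fun setT b' ->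
  {ae rho1, forall x, a x = a' x} -> {ae rho2, forall y, b y = b' y} ->
  marginal_equations a b -> marginal_equations a' b'.
Proof.
move=> ma mb ma' mb' aa' bb' [eq1 eq2].
have SS' : {ae mu, forall z, slk a b z = slk a' b' z}.
  apply: filterS2 (ae_marginal measurable_fst (product_fst rho1 rho2) aa')
    (ae_marginal measurable_snd (product_snd rho1 rho2) bb') => z ha hb.
  by rewrite /scaled_slack ha hb.
have mf d (T : measurableType d) (p : X * Y -> T) (A : set T) a0 b0 :
    measurable_fun setT p -> measurable A ->
    measurable_fun setT a0 -> measurable_fun setT b0 ->
    measurable_fun setT (fun z => (\1_A (p z) * dpsi (slk a0 b0 z))%:E).
  move=> mp mA ma0 mb0; apply/measurable_EFinP; apply: measurable_funM.
    exact: measurableT_comp.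
  apply: measurableT_comp (measurable_conjugate_deriv H Hd) _.
  exact: measurable_scaled_slack.
split=> A mA.
- rewrite -(eq1 A mA); apply: ae_eq_integral => //.
  + exact: (mf _ _ fst A a' b' measurable_fst mA ma' mb').
  + exact: (mf _ _ fst A a b measurable_fst mA ma mb).
  + by apply: filterS SS' => z -> _.
- rewrite -(eq2 A mA); apply: ae_eq_integral => //.
  + exact: (mf _ _ snd A a' b' measurable_snd mA ma' mb').
  + exact: (mf _ _ snd A a b measurable_snd mA ma mb).
  + by apply: filterS SS' => z -> _.
Qed.

(** Clipping to [[- K, K]] changes the representatives on null sets only and turns essential bounds
    into bounds at every point, after which the slack is bounded too. *)
Lemma marginal_equations_bounded u v a b :
  represents eps rho1 u a -> represents eps rho2 v b -> marginal_equations a b ->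
  exists a' b' (K : R), [/\ represents eps rho1 u a', represents eps rho2 v b',
    (forall x, `|a' x| <= K)%R, (forall y, `|b' y| <= K)%R &
    marginal_equations a' b'].
Proof.
move=> [ma ua] [mb vb] eqs.
have [K [aK bK]] := marginal_equations_bounds ma mb eqs.
(* Clipping requires [- K <= K]. For negative [K] the bound on [|a|] fails everywhere, which is
   impossible for a probability. *)
have [K0 | K0] := ltP K 0%R.
  have : rho1.-negligible setT.
    by apply: negligibleS aK => x _ /= h; have := normr_ge0 (a x); lra.
  move=> /negligibleP => /(_ measurableT); rewrite [LHS]probability_setT => /eqP.
  by rewrite onee_eq0.
pose clip (r : R) := (Num.max (- K) (Num.min r K))%R.
have clipK r : (`|clip r| <= K)%R.
  rewrite ler_norml /clip le_max lexx/= ge_max ge_min lexx orbT andbT.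
  lra.
have clip_id r : (`|r| <= K)%R -> r = clip r.
  rewrite ler_norml => /andP[r1 r2]; rewrite /clip (min_idPl r2).
  by apply/esym/max_idPr.
have mclip d (T : measurableType d) (f : T -> R) :
    measurable_fun setT f -> measurable_fun setT (clip \o f).
  by move=> mf; apply: measurable_maxr => //; exact: measurable_minr.
have aa' : {ae rho1, forall x, a x = (clip \o a) x}.
  by apply: filterS aK => x; exact: clip_id.
have bb' : {ae rho2, forall x, b x = (clip \o b) x}.
  by apply: filterS bK => x; exact: clip_id.
exists (clip \o a), (clip \o b), K; split.
- by split; [exact: mclip|apply: filterS2 ua aa' => x -> <-].
- by split; [exact: mclip|apply: filterS2 vb bb' => x -> <-].
- by move=> x; exact: clipK.
- by move=> x; exact: clipK.
- by apply: (marginal_equations_ae ma mb _ _ aa' bb' eqs); exact: mclip.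
Qed.

End first_order_conditions.

(** * From maximal potentials to the marginal equations *)

Section optimality.
Context {R : realType} (Phi : \bar R -> \bar R) (eps : R).
Hypothesis H : is_entropy Phi.
Hypothesis Hd : forall y : R, derivable (conjugate_real Phi) y 1%R.
Hypothesis eps0 : (0 < eps)%R.
Local Notation psi := (conjugate_real Phi).
Local Notation dpsi := ((conjugate_real Phi)^`()%classic).
Context {d1 d2} {X : measurableType d1} {Y : measurableType d2}.
Variables (c : X * Y -> R) (M : R).
Hypothesis mc : measurable_fun setT c.
Hypothesis cM : forall z, (`|c z| <= M)%R.
Variables (rho1 : probability X R) (rho2 : probability Y R).
Local Notation mu := (rho1 \x rho2 : probability (X * Y)%type R).
Local Notation slk := (scaled_slack eps c).
Local Notation RN g := ('d (charge_of_finite_measure g) '/d mu).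

Section maximal_potentials.
Variables (u : X -> \bar R) (v : Y -> \bar R).
Hypothesis Lu : Lphi Phi eps rho1 u.
Hypothesis Lv : Lphi Phi eps rho2 v.
Hypothesis dual_oo : -oo < dual Phi eps c rho1 rho2 u v.
Hypothesis u_max : forall u', Lphi Phi eps rho1 u' ->
  dual Phi eps c rho1 rho2 u' v <= dual Phi eps c rho1 rho2 u v.
Hypothesis v_max : forall v', Lphi Phi eps rho2 v' ->
  dual Phi eps c rho1 rho2 u v' <= dual Phi eps c rho1 rho2 u v.

Section fixed_representatives.
Variables (a : X -> R) (b : Y -> R).
Hypotheses (ua : represents eps rho1 u a) (vb : represents eps rho2 v b).

Let mfu : measurable_fun setT u. Proof. by case: Lu. Qed.
Let mfv : measurable_fun setT v. Proof. by case: Lv. Qed.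
Let ma : measurable_fun setT a. Proof. by case: ua. Qed.
Let mb : measurable_fun setT b. Proof. by case: vb. Qed.
Let props := dual_gtNy_represents H eps0 mc cM Lu Lv dual_oo ua vb.
Let ia : rho1.-integrable setT (EFin \o a). Proof. by case: props.1. Qed.
Let ipa : rho1.-integrable setT (EFin \o (psi \o a)). Proof. by case: props.1. Qed.
Let ipa0 : 0 < \int[rho1]_x (psi (a x))%:E. Proof. by case: props.1. Qed.
Let ib : rho2.-integrable setT (EFin \o b). Proof. by case: props.2.1. Qed.
Let ipb : rho2.-integrable setT (EFin \o (psi \o b)). Proof. by case: props.2.1. Qed.
Let ipb0 : 0 < \int[rho2]_x (psi (b x))%:E. Proof. by case: props.2.1. Qed.
Let ipS : mu.-integrable setT (EFin \o (psi \o slk a b)). Proof. exact: props.2.2. Qed.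
Let iS : mu.-integrable setT (EFin \o slk a b).
Proof.
exact: (integrable_scaled_slack eps mc cM (product_fst rho1 rho2)
  (product_snd rho1 rho2) ia ib).
Qed.

Let value_le (A A' B P P' : \bar R) : A \is a fin_num -> A' \is a fin_num ->
  B \is a fin_num -> P \is a fin_num -> P' \is a fin_num ->
  eps%:E * (A + A' + B - P') <= eps%:E * (A + B - P) -> A' <= P' - P.
Proof.
move: A A' B P P' => [A| |] [A'| |] [B| |] [P| |] [P'| |] //.
by rewrite -!EFinM !lee_fin ler_pM2l//; lra.
Qed.

(** This is [opt] for the first projection: the competitor is [eps * (a + h)], and finiteness of all
    terms allows the common ones to cancel. *)
Let first_variation (h : X -> R) : measurable_fun setT h ->
  (exists K : R, forall x, (`|h x| <= K)%R) ->
  rho1.-integrable setT (EFin \o (fun x => psi (a x + h x)%R)) ->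
  0 < \int[rho1]_x (psi (a x + h x)%R)%:E ->
  mu.-integrable setT (EFin \o (fun z => psi (slk a b z + h z.1)%R)) ->
  \int[rho1]_x (h x)%:E <=
  \int[mu]_z (psi (slk a b z + h z.1) - psi (slk a b z))%:E.
Proof.
move=> mh [K hK] iph ph ipSh.
have ih : rho1.-integrable setT (EFin \o h) by exact: bounded_integrable hK.
have mah : measurable_fun setT (fun x => a x + h x)%R by exact: measurable_funD.
have iah := integrable_addr ia ih.
have slkE z : slk (fun x => a x + h x)%R b z = (slk a b z + h z.1)%R.
  by rewrite /scaled_slack; ring.
have PE : \int[mu]_z (psi (slk (fun x => a x + h x)%R b z))%:E =
    \int[mu]_z (psi (slk a b z + h z.1)%R)%:E.
  by apply: eq_integral => z _; rewrite slkE.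
have Lah : Lphi Phi eps rho1 (fun x => (eps * (a x + h x))%:E).
  exact: (Lphi_scale H eps0 mah iph ph).
have [mfah _ _] := Lah.
have := u_max Lah.
rewrite (dual_represents H eps0 mc mfu mfv ua vb ia ib).
rewrite (dual_represents H eps0 mc mfah mfv (representsE eps rho1 mah) vb iah ib).
rewrite (integralD_EFin measurableT ia ih).
rewrite PE => /value_le; rewrite -(integralB_EFin measurableT ipSh ipS); apply.
- exact: (integrable_fin_num measurableT ia).
- exact: (integrable_fin_num measurableT ih).
- exact: (integrable_fin_num measurableT ib).
- exact: (integrable_fin_num measurableT ipS).
- exact: (integrable_fin_num measurableT ipSh).
Qed.

Let second_variation (h : Y -> R) : measurable_fun setT h ->
  (exists K : R, forall x, (`|h x| <= K)%R) ->
  rho2.-integrable setT (EFin \o (fun y => psi (b y + h y)%R)) ->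
  0 < \int[rho2]_y (psi (b y + h y)%R)%:E ->
  mu.-integrable setT (EFin \o (fun z => psi (slk a b z + h z.2)%R)) ->
  \int[rho2]_y (h y)%:E <=
  \int[mu]_z (psi (slk a b z + h z.2) - psi (slk a b z))%:E.
Proof.
move=> mh [K hK] iph ph ipSh.
have ih : rho2.-integrable setT (EFin \o h) by exact: bounded_integrable hK.
have mbh : measurable_fun setT (fun x => b x + h x)%R by exact: measurable_funD.
have ibh := integrable_addr ib ih.
have slkE z : slk a (fun x => b x + h x)%R z = (slk a b z + h z.2)%R.
  by rewrite /scaled_slack; ring.
have PE : \int[mu]_z (psi (slk a (fun x => b x + h x)%R z))%:E =
    \int[mu]_z (psi (slk a b z + h z.2)%R)%:E.
  by apply: eq_integral => z _; rewrite slkE.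
have Lbh : Lphi Phi eps rho2 (fun x => (eps * (b x + h x))%:E).
  exact: (Lphi_scale H eps0 mbh iph ph).
have [mfbh _ _] := Lbh.
have := v_max Lbh.
rewrite (dual_represents H eps0 mc mfu mfv ua vb ia ib).
rewrite (dual_represents H eps0 mc mfu mfbh ua (representsE eps rho2 mbh) ia ibh).
rewrite (integralD_EFin measurableT ib ih) ![\int[rho1]_x (a x)%:E + _]addeC.
rewrite PE => /value_le; rewrite -(integralB_EFin measurableT ipSh ipS); apply.
- exact: (integrable_fin_num measurableT ib).
- exact: (integrable_fin_num measurableT ih).
- exact: (integrable_fin_num measurableT ia).
- exact: (integrable_fin_num measurableT ipS).
- exact: (integrable_fin_num measurableT ipSh).
Qed.

Lemma first_marginal_le_of_max : first_marginal_le Phi eps c rho1 rho2 a b.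
Proof.
move=> A N mA aN; exact: (marginal_le H Hd measurable_fst
  ma iS ipa ipa0 ipS first_variation mA aN).
Qed.

Lemma second_marginal_le_of_max : second_marginal_le Phi eps c rho1 rho2 a b.
Proof.
move=> B N mB bN; exact: (marginal_le H Hd measurable_snd
  mb iS ipb ipb0 ipS second_variation mB bN).
Qed.

Lemma marginal_equations_of_max (K : R) : (forall x, a x <= K)%R ->
  (forall y, b y <= K)%R -> marginal_equations Phi eps c rho1 rho2 a b.
Proof.
move=> aK bK.
(* A single constant above [a], [b] and the slack, as [marginal_ge] takes one bound for both the
   potential and the slack. *)
pose K' := (`|K| + `|K| + `|eps^-1 * M|)%R.
have KK' : (K <= K')%R.
  have := ler_norm K; have := normr_ge0 K; have := normr_ge0 (eps^-1 * M)%R.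
  by rewrite /K'; lra.
have SK z : (slk a b z <= K')%R.
  have : (- (eps^-1 * c z) <= eps^-1 * M)%R.
    rewrite -mulrN; apply: ler_wpM2l; first by rewrite invr_ge0 ltW.
    by apply: le_trans (ler_norm _) _; rewrite normrN.
  have := aK z.1; have := bK z.2; have := ler_norm K.
  have := ler_norm (eps^-1 * M)%R; rewrite /scaled_slack /K'; lra.
split=> A mA; apply/eqP; rewrite eq_le; apply/andP; split.
- by apply: (first_marginal_le_of_max (N := K) mA) => z _.
- apply: (marginal_ge H Hd measurable_fst ma iS ipa ipa0 ipS first_variation mA _ SK).
  by move=> z; exact: le_trans (aK z) KK'.
- by apply: (second_marginal_le_of_max (N := K) mA) => z _.
- apply: (marginal_ge H Hd measurable_snd mb iS ipb ipb0 ipS second_variation mA _ SK).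
  by move=> z; exact: le_trans (bK z) KK'.
Qed.

End fixed_representatives.

(** The variations are carried out twice, on different representatives of the same potentials. On
    arbitrary ones they give the marginal inequalities, hence essential upper bounds; after
    truncation at these bounds, increasing perturbations become admissible and the inequalities
    become equalities. *)
Lemma represented_marginal_equations_of_max : exists a b,
  [/\ represents eps rho1 u a, represents eps rho2 v b &
      marginal_equations Phi eps c rho1 rho2 a b].
Proof.
have [a [b [ua vb]]] := dual_gtNy_represented H eps0 Lu Lv dual_oo.
have [ma ua'] := ua; have [mb vb'] := vb.
have [Ka aK] := first_ae_upper_bound H Hd eps0 mc cM ma mb
  (first_marginal_le_of_max ua vb).
have [Kb bK] := second_ae_upper_bound H Hd eps0 mc cM ma mb
  (second_marginal_le_of_max ua vb).
pose K := (`|Ka| + `|Kb|)%R.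
have KaK : (Ka <= K)%R by rewrite /K (le_trans (ler_norm _))// lerDl.
have KbK : (Kb <= K)%R by rewrite /K (le_trans (ler_norm _))// lerDr.
pose trunc (r : R) := (Num.min r K)%R.
have ua1 : represents eps rho1 u (trunc \o a).
  split; first exact: measurable_minr.
  by apply: filterS2 ua' aK => x -> h; rewrite /= /trunc min_l// (le_trans h).
have vb1 : represents eps rho2 v (trunc \o b).
  split; first exact: measurable_minr.
  by apply: filterS2 vb' bK => x -> h; rewrite /= /trunc min_l// (le_trans h).
exists (trunc \o a), (trunc \o b); split => //.
by apply: (marginal_equations_of_max ua1 vb1 (K := K)) => z;
  rewrite /= /trunc ge_min lexx orbT.
Qed.

End maximal_potentials.
End optimality.

(** * Complementary slackness *)

Section complementary_slackness.
Context {R : realType} (Phi : \bar R -> \bar R) (eps : R).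
Hypothesis H : is_entropy Phi.
Hypothesis Hd : forall y : R, derivable (conjugate_real Phi) y 1%R.
Hypothesis eps0 : (0 < eps)%R.
Local Notation psi := (conjugate_real Phi).
Local Notation dpsi := ((conjugate_real Phi)^`()%classic).
Context {d1 d2} {X : measurableType d1} {Y : measurableType d2}.
Variables (c : X * Y -> R) (M : R).
Hypothesis mc : measurable_fun setT c.
Hypothesis cM : forall z, (`|c z| <= M)%R.
Variables (rho1 : probability X R) (rho2 : probability Y R).
Local Notation mu := (rho1 \x rho2 : probability (X * Y)%type R).
Local Notation slk := (scaled_slack eps c).
Local Notation RN g := ('d (charge_of_finite_measure g) '/d mu).
Variables (u : X -> \bar R) (v : Y -> \bar R).
Hypothesis mfu : measurable_fun setT u.
Hypothesis mfv : measurable_fun setT v.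

Lemma gamma_star_represents a b A : represents eps rho1 u a ->
  represents eps rho2 v b -> measurable A ->
  gamma_star Phi eps c rho1 rho2 u v A =
  \int[mu]_(z in A) (dpsi (slk a b z))%:E.
Proof.
move=> ua vb mA; apply: ae_eq_integral => //.
- apply: measurable_funTS; apply: measurableT_comp (measurable_conjugate' H Hd) _.
  exact: measurable_slack.
- apply: measurable_funTS; apply/measurable_EFinP.
  apply: measurableT_comp (measurable_conjugate_deriv H Hd) _.
  by apply: measurable_scaled_slack => //; [case: ua|case: vb].
- by apply: filterS (slack_represents eps0 c ua vb) => z -> _.
Qed.

(** Nothing is known here about the dual value. Instead, [conjugate'] vanishes at [-oo], so
    [gamma_star] gives no mass to the cylinder over the set where a potential is [-oo], and its
    marginals make that set null. *)
Lemma marginal_equations_of_gamma_star g :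
  (forall x, u x < +oo) -> (forall y, v y < +oo) -> couplings rho1 rho2 g ->
  is_gamma_star Phi eps c rho1 rho2 u v g -> exists a b,
  [/\ represents eps rho1 u a, represents eps rho2 v b &
      marginal_equations Phi eps c rho1 rho2 a b].
Proof.
move=> uoo voo [g1 g2] gs.
have ninfty d (T : measurableType d) (f : T -> \bar R) :
    measurable_fun setT f -> measurable [set x | f x = -oo].
  move=> mf; rewrite (_ : [set _ | _] = f @^-1` [set -oo])//.
  by rewrite -[X in measurable X]setTI; exact: mf.
have ufin : {ae rho1, forall x, u x \is a fin_num}.
  exists [set x | u x = -oo]; split.
  - exact: ninfty.
  - rewrite -g1; last exact: ninfty.
    rewrite gs; last by apply: measurableX => //; exact: ninfty.
    apply: integral0_eq => -[x y] [/= ux _]; rewrite /slack /= ux.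
    by have := voo y; case: (v y) => [r| |] // _; rewrite gt0_muleNy ?lte_fin ?invr_gt0.
  - by move=> x /= /negP; have := uoo x; case: (u x).
have vfin : {ae rho2, forall x, v x \is a fin_num}.
  exists [set x | v x = -oo]; split.
  - exact: ninfty.
  - rewrite -g2; last exact: ninfty.
    rewrite gs; last by apply: measurableX => //; exact: ninfty.
    apply: integral0_eq => -[x y] [/= _ vy]; rewrite /slack /= vy.
    by have := uoo x; case: (u x) => [r| |] // _; rewrite gt0_muleNy ?lte_fin ?invr_gt0.
  - by move=> y /= /negP; have := voo y; case: (v y).
have ua := represents_ae_finite eps0 mfu ufin.
have vb := represents_ae_finite eps0 mfv vfin.
eexists; eexists; split; [exact: ua|exact: vb|split=> A mA].
- rewrite -(g1 A mA) gs; last exact: measurableX.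
  rewrite (gamma_star_represents ua vb); last exact: measurableX.
  rewrite [RHS]integral_mkindic; apply: eq_integral => z _; congr (_ * _)%:E.
  by rewrite !indicE in_setX in_setT andbT.
- rewrite -(g2 A mA) gs; last exact: measurableX.
  rewrite (gamma_star_represents ua vb); last exact: measurableX.
  rewrite [RHS]integral_mkindic; apply: eq_integral => z _; congr (_ * _)%:E.
  by rewrite !indicE in_setX in_setT.
Qed.

Section optimal_potentials.
Variables (a : X -> R) (b : Y -> R) (K : R).
Hypothesis ua : represents eps rho1 u a.
Hypothesis vb : represents eps rho2 v b.
Hypothesis aK : forall x, (`|a x| <= K)%R.
Hypothesis bK : forall y, (`|b y| <= K)%R.
Hypothesis eqs : marginal_equations Phi eps c rho1 rho2 a b.

Let ma : measurable_fun setT a. Proof. by case: ua. Qed.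
Let mb : measurable_fun setT b. Proof. by case: vb. Qed.
Let mS : measurable_fun setT (slk a b).
Proof. exact: measurable_scaled_slack. Qed.
Let ia : rho1.-integrable setT (EFin \o a).
Proof. exact: bounded_integrable aK. Qed.
Let ib : rho2.-integrable setT (EFin \o b).
Proof. exact: bounded_integrable bK. Qed.

Let SK z : (- (K + K + eps^-1 * M) <= slk a b z <= K + K + eps^-1 * M)%R.
Proof.
have : (`|eps^-1 * c z| <= eps^-1 * M)%R.
  have e0 : (0 <= eps^-1)%R by rewrite invr_ge0 ltW.
  by rewrite normrM (ger0_norm e0) ler_wpM2l.
have := aK z.1; have := bK z.2.
rewrite !ler_norml /scaled_slack => /andP[? ?] /andP[? ?] /andP[? ?].
by apply/andP; split; lra.
Qed.

Let integrable_monotone (f : R -> R) : measurable_fun setT f ->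
  {homo f : x y / (x <= y)%R} -> mu.-integrable setT (EFin \o (f \o slk a b)).
Proof.
move=> mf f_nd.
apply: (@integrable_between _ _ _ mu _
  (fun=> f (- (K + K + eps^-1 * M))%R) (fun=> f (K + K + eps^-1 * M)%R)).
- exact: measurableT_comp.
- by move=> z; have /andP[? ?] := SK z; rewrite !f_nd.
- exact: finite_measure_integrable_cst.
- exact: finite_measure_integrable_cst.
Qed.

Let ipS : mu.-integrable setT (EFin \o (psi \o slk a b)).
Proof.
apply: integrable_monotone; first exact: (measurable_conjugate_real H).
exact: (conjugate_real_nondecreasing H).
Qed.

Let idS : mu.-integrable setT (EFin \o (dpsi \o slk a b)).
Proof.
apply: integrable_monotone; first exact: (measurable_conjugate_deriv H Hd).
exact: (conjugate_deriv_nondecreasing H Hd).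
Qed.

Lemma gamma_star_exists : exists2 g : probability (X * Y)%type R,
  couplings rho1 rho2 g & is_gamma_star Phi eps c rho1 rho2 u v g.
Proof.
have [|g gE] := probability_of_density
  (fun z => conjugate_deriv_ge0 H Hd (slk a b z)) idS.
  have := eqs.1 setT measurableT; rewrite [RHS]probability_setT => <-.
  by apply: eq_integral => z _; rewrite indicT mul1r.
exists g; last by move=> A mA; rewrite gE// (gamma_star_represents ua vb).
split=> A mA.
- rewrite gE; last exact: measurableX.
  rewrite -(eqs.1 A mA) integral_mkindic; apply: eq_integral => z _.
  by congr (_ * _)%:E; rewrite !indicE in_setX in_setT andbT.
- rewrite gE; last exact: measurableX.
  rewrite -(eqs.2 A mA) integral_mkindic; apply: eq_integral => z _.
  by congr (_ * _)%:E; rewrite !indicE in_setX in_setT.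
Qed.

(** By uniqueness of densities the Radon-Nikodym derivative of [g] is [dpsi] of the slack almost
    everywhere, which is the equality case of Young's inequality. *)
Lemma primal_gamma_star g : couplings rho1 rho2 g ->
  is_gamma_star Phi eps c rho1 rho2 u v g ->
  primal Phi eps c rho1 rho2 g = dual Phi eps c rho1 rho2 u v.
Proof.
move=> gC gs.
have gE A : measurable A -> g A = \int[mu]_(z in A) (dpsi (slk a b z))%:E.
  by move=> mA; rewrite gs// (gamma_star_represents ua vb).
have gmu : g `<< mu.
  apply/null_content_dominatesP => A mA muA; rewrite gE//.
  apply: null_set_integral => //; apply: measurable_funTS.
  exact: measurable_int idS.
rewrite (dual_represents H eps0 mc mfu mfv ua vb ia ib).
apply: (primal_eq_value H Hd eps0 mc cM gC ia ib ipS gmu).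
apply: integral_ae_eq => //.
- exact: Radon_Nikodym_integrable.
- exact: measurable_int idS.
- by move=> E _ mE; rewrite -Radon_Nikodym_integral//; exact: gE.
Qed.

Lemma gamma_star_of_primal g : couplings rho1 rho2 g ->
  primal Phi eps c rho1 rho2 g <= dual Phi eps c rho1 rho2 u v ->
  is_gamma_star Phi eps c rho1 rho2 u v g.
Proof.
move=> gC; rewrite (dual_represents H eps0 mc mfu mfv ua vb ia ib).
move=> /(primal_le_value H Hd eps0 mc cM gC ia ib ipS)[gmu RNE] A mA.
rewrite (gamma_star_represents ua vb)//.
have -> : g A = \int[mu]_(z in A) RN g z by rewrite -Radon_Nikodym_integral.
apply: ae_eq_integral => //.
- apply: measurable_funTS; exact: (measurable_int _ (Radon_Nikodym_integrable _)).
- apply: measurable_funTS; exact: measurable_int idS.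
- by apply: filterS RNE => z h _; exact: h.
Qed.

(** [gamma_star] is a coupling whose primal value is the dual value, so weak duality leaves no room
    between the two. *)
Lemma OT_eq_dual : Lphi Phi eps rho1 u -> Lphi Phi eps rho2 v ->
  OT Phi eps c rho1 rho2 = dual Phi eps c rho1 rho2 u v.
Proof.
move=> Lu Lv; have [g gC gs] := gamma_star_exists.
apply/eqP; rewrite eq_le; apply/andP; split.
  by rewrite -(primal_gamma_star gC gs); apply: ereal_inf_lbound; exists g.
apply: le_trans (dual_sup_le_OT H eps0 mc cM rho1 rho2).
by apply: ereal_sup_ubound; exists (u, v).
Qed.

End optimal_potentials.
End complementary_slackness.

Section essentially_bounded.
Context {R : realType} (eps : R) d {T : measurableType d} (rho : probability T R).

Lemma represents_Lnorm_oo (u : T -> \bar R) (a : T -> R) (K : R) :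
  represents eps rho u a -> (forall x, `|a x| <= K)%R -> 'N[rho]_+oo[u] < +oo.
Proof.
move=> [_ ua] aK; rewrite unlock; case: ifPn => // _.
apply: (@le_lt_trans _ _ (`|eps| * K)%:E); last by rewrite ltry.
apply/ess_sup_inf.ess_supP; apply: filterS ua => x /= ->.
by rewrite abse_EFin lee_fin normrM ler_wpM2l.
Qed.

End essentially_bounded.

Theorem theorem3p6 (R : realType) (eps : R) (X Y : completeMetricType R)
    (c : borel X * borel Y -> R) (Phi : \bar R -> \bar R)
    (rho1 : probability (borel X) R) (rho2 : probability (borel Y) R)
    (u : borel X -> \bar R) (v : borel Y -> \bar R) :
  (0 < eps)%R ->
  separable X -> separable Y ->
  measurable_fun [set: borel X * borel Y] c ->
  (exists M : R, forall z, (`|c z| <= M)%R) ->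
  is_entropy Phi ->
  (forall y : R, derivable (conjugate_real Phi) y 1%R) ->
  Lphi Phi eps rho1 u -> Lphi Phi eps rho2 v ->
  let maximizers := dual Phi eps c rho1 rho2 u v =
                    dual_sup Phi eps c rho1 rho2 in
  let maximality := is_transform_of_left Phi eps c rho1 rho2 u v /\
                    is_transform_of_right Phi eps c rho1 rho2 v u in
  let slackness := exists2 g : probability (borel X * borel Y)%type R,
                     couplings rho1 rho2 g &
                     is_gamma_star Phi eps c rho1 rho2 u v g in
  let duality := OT Phi eps c rho1 rho2 = dual Phi eps c rho1 rho2 u v in
  [/\ [<-> maximizers; maximality; slackness; duality],
      maximality -> 'N[rho1]_+oo[u] < +oo /\ 'N[rho2]_+oo[v] < +oo &
      maximizers ->
        (exists2 g : probability (borel X * borel Y)%type R,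
           is_gamma_star Phi eps c rho1 rho2 u v g &
           is_minimizer Phi eps c rho1 rho2 g) /\
        (forall g : probability (borel X * borel Y)%type R,
           is_minimizer Phi eps c rho1 rho2 g ->
           is_gamma_star Phi eps c rho1 rho2 u v g)].
Proof.
move=> eps0 _ _ mc [M cM] H Hd Lu Lv maximizers maximality slackness duality.
have [mfu uoo _] := Lu; have [mfv voo _] := Lv.
(* The common source of slackness, duality, boundedness and the statement on minimizers: bounded
   representatives that solve the marginal equations. *)
pose optimal := exists a b (K : R),
  [/\ represents eps rho1 u a, represents eps rho2 v b,
      (forall x, `|a x| <= K)%R, (forall y, `|b y| <= K)%R &
      marginal_equations Phi eps c rho1 rho2 a b].
have bounded a b : represents eps rho1 u a -> represents eps rho2 v b ->
    marginal_equations Phi eps c rho1 rho2 a b -> optimal.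
  exact: (marginal_equations_bounded H Hd eps0 mc cM).
have max_maximality : maximizers -> maximality.
  (* [argmax] demands a value above [-oo], which the supremum inherits from constant potentials. *)
  move=> uv_max; have dual_oo : -oo < dual Phi eps c rho1 rho2 u v.
    by rewrite uv_max; exact: (dual_sup_gtNy H eps0 mc cM).
  split; (split; [by []|exact: dual_oo|move=> w Lw; rewrite uv_max]).
    by apply: ereal_sup_ubound; exists (u, w).
  by apply: ereal_sup_ubound; exists (w, v).
have maximality_optimal : maximality -> optimal.
  move=> [[_ dual_oo v_max] [_ _ u_max]].
  have [a [b [ua vb eqs]]] :=
    represented_marginal_equations_of_max H Hd eps0 mc cM Lu Lv dual_oo u_max v_max.
  exact: bounded eqs.
have slackness_optimal : slackness -> optimal.
  move=> [g gC gs]; have [a [b [ua vb eqs]]] :=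
    marginal_equations_of_gamma_star H Hd eps0 mc mfu mfv uoo voo gC gs.
  exact: bounded eqs.
split.
- split; [exact: max_maximality|split; [|split]].
  + move=> /maximality_optimal[a [b [K [ua vb aK bK eqs]]]].
    exact: (gamma_star_exists H Hd eps0 mc cM mfu mfv ua vb aK bK eqs).
  + move=> /slackness_optimal[a [b [K [ua vb aK bK eqs]]]].
    exact: (OT_eq_dual H Hd eps0 mc cM mfu mfv ua vb aK bK eqs).
  + move=> OT_dual; apply/eqP; rewrite eq_le; apply/andP; split.
      by apply: ereal_sup_ubound; exists (u, v).
    by rewrite -OT_dual; exact: (dual_sup_le_OT H eps0 mc cM).
- move=> /maximality_optimal[a [b [K [ua vb aK bK _]]]].
  by split; [exact: represents_Lnorm_oo ua aK|exact: represents_Lnorm_oo vb bK].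
move=> /max_maximality/maximality_optimal[a [b [K [ua vb aK bK eqs]]]].
have OT_dual := OT_eq_dual H Hd eps0 mc cM mfu mfv ua vb aK bK eqs Lu Lv.
split=> [|g [gC g_min]].
  have [g gC gs] := gamma_star_exists H Hd eps0 mc cM mfu mfv ua vb aK bK eqs.
  exists g => //; split => //; rewrite OT_dual.
  exact: (primal_gamma_star H Hd eps0 mc cM mfu mfv ua vb aK bK).
(* A minimizer attains the dual value, so it falls in the equality case, which prescribes its
   density. *)
apply: (gamma_star_of_primal H Hd eps0 mc cM mfu mfv ua vb aK bK) => //.
by rewrite g_min OT_dual.
Qed.
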